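(* Let $F$ be $\mathbb{R}$ or $\mathbb{C}$, and let $K\subset F$, $d=[K:\mathbb{Q}]$, $D$, $\mathcal{Q}$, $\mathcal{O}$ and $\kappa$ be as in the context. Let $I\lhd O_K$ be a nonzero ideal. (1) If $F=\mathbb{R}$, then for every $x\ne\pm1$ in $\mathcal{Q}^1(I)$, \[ |\mathrm{Tr}_D(x)|>\frac{1}{2^{d-2}\,N(\langle 2\rangle+\kappa I)}\,N(I)^2-2 \qquad\text{and therefore}\qquad |\mathrm{Tr}_D(x)|>\frac{1}{2^{2d-2}}\,N(I)^2-2 . \] (2) If $F=\mathbb{C}$, then for every $x\ne\pm1$ in $\mathcal{Q}^1(I)$, \[ |\mathrm{Tr}_D(x)|>\frac{1}{2^{d/2-2}\,N(\langle2\rangle+\kappa I)^{1/2}}\,N(I)-2\ \ge\ \frac{1}{2^{d-2}}\,|N(I)|-2 . \]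
   Context: $K$ is a number field of degree $d$ over $\mathbb{Q}$ viewed as a subfield of $F$: if $F=\mathbb{R}$, $K$ is totally real; if $F=\mathbb{C}$, $K$ has exactly one complex place, given by $K\subset\mathbb{C}$, and the other archimedean places are real. $D$ is a quaternion division algebra with center $K$, split by $K\subset F$ (so $D\subset D\otimes_KF\cong\mathrm{M}_2(F)$), such that $D\otimes_{K,\sigma}\mathbb{R}$ is a division algebra for every other (real) embedding $\sigma:K\hookrightarrow\mathbb{R}$. It is presented as $D=(a,b)_K=K[i,j\mid i^2=a,\ j^2=b,\ ji=-ij]$ with $a,b\in O_K$, where $O_K$ is the ring of integers of $K$. Put $\mathcal{O}=O_K\oplus O_Ki\oplus O_Kj\oplus O_Kij$. $\mathcal{Q}$ is an order of $D$ containing $O_K$, and $\kappa\in O_K$ is a nonzero element with $\mathcal{Q}\subseteq\frac1\kappa\mathcal{O}$. $\mathcal{Q}^1$ is the group of elements of reduced norm $1$ in $\mathcal{Q}$, and $\mathcal{Q}^1(I)=\ker(\mathcal{Q}^1\to(\mathcal{Q}/I\mathcal{Q})^\times)$. $\mathrm{Tr}_D$ is the reduced trace, $\mathrm{Tr}_D(x_0+x_1i+x_2j+x_3ij)=2x_0\in K\subset F$, and $|\cdot|$ is the absolute value of $F$. For an ideal $J\lhd O_K$, $N(J)=|O_K/J|$; $\langle2\rangle=2O_K$.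
   Formalization: The strict lower bounds on |Tr_D(x)| are proved only as ''≥'' when d=1 (F=ℝ) or d=2 (F=ℂ), where strictness fails: e.g. K=ℚ, D=(-1,3), I=3ℤ, κ=2, x=(-7+3i+3j+3ij)/2 has |Tr_D(x)|=7, equal to both bounds. *)

(* Defs.v *)
From HB Require Import structures.
From mathcomp Require Import all_boot all_order all_algebra all_field.
From mathcomp Require Import finmap boolp classical_sets functions cardinality.
From mathcomp Require Import reals exp.
From mathcomp Require Export complex.
From mathcomp Require Import ring.

Set Implicit Arguments.
Unset Strict Implicit.
Unset Printing Implicit Defensive.

Import GRing.Theory Num.Theory.
Local Open Scope classical_set_scope.
Local Open Scope ring_scope.

(* [quat a b] is (a,b)_F, and [Quat x0 x1 x2 x3] stands for
   x0 + x1 i + x2 j + x3 ij.  For a = 0 or b = 0 it is not a central simple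
   algebra; this is excluded by [division_algebra (quat a b)]. *)
Record quat (F : fieldType) (a b : F) : Type :=
  Quat { qre : F; qi : F; qj : F; qk : F }.

Section QuatAlgebra.
Variables (F : fieldType) (a b : F).
Local Notation Q := (quat a b).

Definition quat_tuple (x : Q) := (qre x, qi x, qj x, qk x).
Definition tuple_quat (t : F * F * F * F) : Q :=
  let: (x0, x1, x2, x3) := t in Quat a b x0 x1 x2 x3.

Lemma quat_tupleK : cancel quat_tuple tuple_quat. Proof. by case. Qed.

HB.instance Definition _ := Choice.copy Q (can_type quat_tupleK).

Lemma quat_eq (x y : Q) : qre x = qre y -> qi x = qi y -> qj x = qj y ->
  qk x = qk y -> x = y.
Proof. by case: x y => [? ? ? ?] [? ? ? ?] /= -> -> -> ->. Qed.

Definition quat_zero : Q := Quat a b 0 0 0 0.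
Definition quat_opp (x : Q) : Q := Quat a b (- qre x) (- qi x) (- qj x) (- qk x).
Definition quat_add (x y : Q) : Q :=
  Quat a b (qre x + qre y) (qi x + qi y) (qj x + qj y) (qk x + qk y).
Definition quat_one : Q := Quat a b 1 0 0 0.
(* Bilinear extension of i^2 = a, j^2 = b, ji = - ij. *)
Definition quat_mul (x y : Q) : Q := Quat a b
  (qre x * qre y + a * qi x * qi y + b * qj x * qj y - a * b * qk x * qk y)
  (qre x * qi y + qi x * qre y - b * qj x * qk y + b * qk x * qj y)
  (qre x * qj y + qj x * qre y + a * qi x * qk y - a * qk x * qi y)
  (qre x * qk y + qk x * qre y + qi x * qj y - qj x * qi y).
Definition quat_scale (c : F) (x : Q) : Q :=
  Quat a b (c * qre x) (c * qi x) (c * qj x) (c * qk x).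

Fact quat_addA : associative quat_add.
Proof. by move=> x y z; apply: quat_eq => /=; ring. Qed.
Fact quat_addC : commutative quat_add.
Proof. by move=> x y; apply: quat_eq => /=; ring. Qed.
Fact quat_add0 : left_id quat_zero quat_add.
Proof. by move=> x; apply: quat_eq => /=; ring. Qed.
Fact quat_addN : left_inverse quat_zero quat_opp quat_add.
Proof. by move=> x; apply: quat_eq => /=; ring. Qed.

HB.instance Definition _ :=
  GRing.isZmodule.Build Q quat_addA quat_addC quat_add0 quat_addN.

Fact quat_mulA : associative quat_mul.
Proof. by move=> x y z; apply: quat_eq => /=; ring. Qed.
Fact quat_mul1l : left_id quat_one quat_mul.
Proof. by move=> x; apply: quat_eq => /=; ring. Qed.
Fact quat_mul1r : right_id quat_one quat_mul.
Proof. by move=> x; apply: quat_eq => /=; ring. Qed.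
Fact quat_mulDl : left_distributive quat_mul +%R.
Proof. by move=> x y z; apply: quat_eq => /=; ring. Qed.
Fact quat_mulDr : right_distributive quat_mul +%R.
Proof. by move=> x y z; apply: quat_eq => /=; ring. Qed.
Fact quat_one_neq0 : quat_one != 0.
Proof. by apply/eqP => /(congr1 (@qre F a b)) /= /eqP; rewrite oner_eq0. Qed.

HB.instance Definition _ := GRing.Zmodule_isNzRing.Build Q
  quat_mulA quat_mul1l quat_mul1r quat_mulDl quat_mulDr quat_one_neq0.

Fact quat_scaleA c1 c2 x :
  quat_scale c1 (quat_scale c2 x) = quat_scale (c1 * c2) x.
Proof. by apply: quat_eq => /=; ring. Qed.
Fact quat_scale1 : left_id 1 quat_scale.
Proof. by move=> x; apply: quat_eq => /=; ring. Qed.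
Fact quat_scaleDr : right_distributive quat_scale +%R.
Proof. by move=> c x y; apply: quat_eq => /=; ring. Qed.
Fact quat_scaleDl x : {morph quat_scale^~ x : c1 c2 / c1 + c2}.
Proof. by move=> c1 c2; apply: quat_eq => /=; ring. Qed.

HB.instance Definition _ := GRing.Zmodule_isLmodule.Build F Q
  quat_scaleA quat_scale1 quat_scaleDr quat_scaleDl.

Fact quat_scaleAl (c : F) (x y : Q) : c *: (x * y) = (c *: x) * y.
Proof. by apply: quat_eq => /=; ring. Qed.
HB.instance Definition _ := GRing.Lmodule_isLalgebra.Build F Q quat_scaleAl.

Fact quat_scaleAr (c : F) (x y : Q) : c *: (x * y) = x * (c *: y).
Proof. by apply: quat_eq => /=; ring. Qed.
HB.instance Definition _ := GRing.Lalgebra_isAlgebra.Build F Q quat_scaleAr.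

Definition conjq (x : Q) : Q := Quat a b (qre x) (- qi x) (- qj x) (- qk x).
Definition trd (x : Q) : F := 2 * qre x.
Definition nrd (x : Q) : F :=
  qre x ^+ 2 - a * qi x ^+ 2 - b * qj x ^+ 2 + a * b * qk x ^+ 2.

Lemma trdE (x : Q) : x + conjq x = (trd x)%:A.
Proof. by apply: quat_eq; rewrite /trd /=; ring. Qed.
Lemma nrdE (x : Q) : x * conjq x = (nrd x)%:A.
Proof. by apply: quat_eq; rewrite /nrd /=; ring. Qed.

End QuatAlgebra.

Definition division_algebra (A : nzRingType) : Prop :=
  forall x : A, x != 0 -> exists y : A, x * y = 1 /\ y * x = 1.

Definition split_algebra (F : fieldType) (A : algType F) : Prop :=
  exists f : {lrmorphism A -> 'M[F]_2}, bijective f.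

(* For a field embedding sigma : F -> L, the base change of (a,b)_F along
   sigma is [quat (sigma a) (sigma b)]; the sigma-semilinear ring morphism
   [base_change] satisfies the universal property of x |-> x tensor 1
   ([base_change_univ]). *)
Section BaseChange.
Variables (F L : fieldType) (sigma : {rmorphism F -> L}) (a b : F).

Definition base_change (x : quat a b) : quat (sigma a) (sigma b) :=
  Quat _ _ (sigma (qre x)) (sigma (qi x)) (sigma (qj x)) (sigma (qk x)).

Lemma base_change_zmod_morphism : zmod_morphism base_change.
Proof. by move=> x y; apply: quat_eq; rewrite /= !(rmorphD, rmorphN). Qed.

Lemma base_change_monoid_morphism : monoid_morphism base_change.
Proof.
split=> [|x y]; apply: quat_eq; rewrite /= ?rmorph0 ?rmorph1 //.
all: by rewrite !(rmorphD, rmorphM, rmorphN).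
Qed.

Lemma base_changeZ c x : base_change (c *: x) = sigma c *: base_change x.
Proof. by apply: quat_eq; rewrite /= rmorphM. Qed.

Lemma base_change_univ (B : algType L) (g : {rmorphism quat a b -> B}) :
  (forall c x, g (c *: x) = sigma c *: g x) ->
  exists2 h : {lrmorphism quat (sigma a) (sigma b) -> B},
    (forall x, h (base_change x) = g x) &
    forall h' : {lrmorphism quat (sigma a) (sigma b) -> B},
      (forall x, h' (base_change x) = g x) -> h' =1 h.
Proof.
move=> gZ.
pose I : quat a b := Quat a b 0 1 0 0.
pose J : quat a b := Quat a b 0 0 1 0.
pose K : quat a b := Quat a b 0 0 0 1.
pose h0 (x : quat (sigma a) (sigma b)) : B :=
  (qre x)%:A + qi x *: g I + qj x *: g J + qk x *: g K.
have dec (x : quat a b) : x = (qre x)%:A + qi x *: I + qj x *: J + qk x *: K.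
  by apply: quat_eq => /=; ring.
have dec' (x : quat (sigma a) (sigma b)) : x = qre x *: base_change 1
    + qi x *: base_change I + qj x *: base_change J + qk x *: base_change K.
  by apply: quat_eq => /=; rewrite ?rmorph0 ?rmorph1; ring.
have h0lin : linear h0.
  move=> c x y; rewrite /h0 /= !scalerDl !scalerDr !scalerA.
  do 2![rewrite [RHS]addrACA; congr (_ + _)].
  by rewrite [RHS]addrACA.
have gAA c : g c%:A = (sigma c)%:A by rewrite gZ rmorph1.
have h0g x : h0 (base_change x) = g x.
  by rewrite {2}(dec x) !rmorphD /= gAA !gZ.
pose hl := GRing.isLinear.Build _ _ _ _ h0 h0lin.
pose hL : {linear _ -> _} := HB.pack h0 hl.
have [_ bcM] := base_change_monoid_morphism.
have h0D x y : h0 (x + y) = h0 x + h0 y by exact: (raddfD hL).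
have h0Z c x : h0 (c *: x) = c *: h0 x by exact: (linearZ_LR hL).
have mulP (f : quat (sigma a) (sigma b) -> B) :
    (forall x y, f (x + y) = f x + f y) -> (forall c x, f (c *: x) = c *: f x) ->
    (forall x, f (base_change x) = g x) -> {morph f : x y / x * y}.
  move=> fD fZ fg x y; rewrite (dec' x) (dec' y).
  rewrite !(mulrDl, mulrDr) -!scalerAl -!scalerAr -!bcM !(fD, fZ) !fg.
  by rewrite !rmorphM !(mulrDl, mulrDr) -!scalerAl -!scalerAr.
have h0M : monoid_morphism h0.
  split; last exact: mulP.
  by rewrite /h0 /= !scale0r !addr0 scale1r.
pose hm := GRing.isMonoidMorphism.Build _ _ h0 h0M.
pose h : {lrmorphism _ -> _} := HB.pack h0 hl hm.
exists h; first exact: h0g.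
move=> h' h'g x; change (h' x = h0 x).
rewrite (dec' x) !(h0D, h0Z) !h0g -!h'g.
move: (base_change 1) (base_change I) (base_change J) (base_change K).
by move=> u v w z; rewrite !linearD !linearZ.
Qed.

End BaseChange.

Section NumberField.
Variable K : fieldExtType rat.

Definition ring_int : set K := [set x | integralOver (intr : int -> K) x].

Definition ideal_ring_int (I : set K) : Prop :=
  [/\ I `<=` ring_int, I 0, (forall x y, I x -> I y -> I (x + y))
    & forall c x, ring_int c -> I x -> I (c * x)].

(* |O_K / J|, counting the cosets x + J; the value is 0 when there are
   infinitely many of them, i.e. for J = 0. *)
Definition ideal_norm (J : set K) : nat :=
  #|` fset_set [set [set x + y | y in J] | x in ring_int]|.

(* <2> + c I *)
Definition two_plus_ideal (c : K) (I : set K) : set K :=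
  [set 2 * x + c * y | x in ring_int & y in I].

Variables a b : K.
Local Notation D := (quat a b).

(* A subring which is a finitely generated Z-module spanning D over Q. *)
Definition is_order (Q : set D) : Prop :=
  [/\ Q 1, (forall x y, Q x -> Q y -> Q (x - y)),
      (forall x y, Q x -> Q y -> Q (x * y)),
      (exists n (e : 'I_n -> D),
         Q = [set \sum_i e i *~ c i | c in [set: 'I_n -> int]])
    & forall x : D, exists2 m : int, m != 0 & Q (x *~ m)].

Definition standard_order : set D :=
  [set x | [/\ ring_int (qre x), ring_int (qi x), ring_int (qj x)
             & ring_int (qk x)]].

(* I Q, the finite sums of products. *)
Definition ideal_order (I : set K) (Q : set D) : set D :=
  [set x | exists n (c : 'I_n -> K) (q : 'I_n -> D),
     [/\ forall i, I (c i), forall i, Q (q i) & x = \sum_i c i *: q i]].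

Definition norm1 (Q : set D) : set D := [set x | Q x /\ nrd x = 1].

Definition congruence_subgroup (Q : set D) (I : set K) : set D :=
  [set x | norm1 Q x /\ ideal_order I Q (x - 1)].

End NumberField.

Section Places.
Variables (R : realType) (K : fieldExtType rat).

Definition real_embedding (s : {rmorphism K -> R[i]}) : Prop :=
  forall x, complex.Im (s x) = 0.

Definition totally_real : Prop :=
  forall s : {rmorphism K -> R[i]}, real_embedding s.

Definition only_complex_place (iota : {rmorphism K -> R[i]}) : Prop :=
  ~ real_embedding iota /\
  forall s : {rmorphism K -> R[i]},
    [\/ real_embedding s, s =1 iota | forall x, s x = conjc (iota x)].

End Places.

Definition absC (R : realType) (z : R[i]) : R := ComplexField.Normc.normc z.

(* Main.v *)
(* Put t = trd x - 2.  Since nrd x = 1, t = - nrd (x - 1), and x - 1 lies in I Q, so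
   t is in I ^ 2; moreover kappa t = 2 v with v in I.  With J = <2> + kappa I this
   gives t J <= 2 I ^ 2, hence 2 ^ d N(I) ^ 2 <= |Norm t| N(J) because
   N(I ^ 2) >= N(I) ^ 2.  At the archimedean places where D is a division algebra the
   reduced norm is positive definite, so the conjugate of t has absolute value < 4
   there, and what remains of |Norm t| is a lower bound at the given place.

   The norm inequality for I ^ 2 comes from the invertibility of I: an element x whose
   powers have a common denominator is integral, because two of them agree modulo the
   finite group t^-1 O / O.  The equality [O : t O] = |Norm t| is computed in the
   lattice of integral combinations of the powers of a primitive element, which is
   commensurable with O because O is contained in the finitely generated group Q. *)
From HB Require Import structures.
Require Import Defs.
From mathcomp Require Import all_boot all_order all_algebra all_field.
From mathcomp Require Import finmap boolp classical_sets cardinality.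
From mathcomp Require Import reals exp complex ring lra zify.
Import Order.TTheory GRing.Theory Num.Theory.
Set Implicit Arguments.
Unset Strict Implicit.
Unset Printing Implicit Defensive.
Local Open Scope classical_set_scope.
Local Open Scope ring_scope.

(** * Subgroups and their index *)

(** The constants come from sharing out [2 ^ d N(I) ^ 2] among [d] embeddings, the definite ones
    taking less than 4 each. Over the reals there are [d - 1] of them, which leaves
    [2 ^ d / 4 ^ (d - 1)]; over the complex numbers the given place occurs together with its
    conjugate, so [d - 2] remain and a square root is taken. The final [- 2] is the passage from [t]
    back to [trd x]. Excluding [x = 1] makes [t] nonzero, excluding [x = -1] makes the bound 4
    strict. Ideal norms are handled as indices of subgroups of [K], which multiply along chains, and
    finiteness of the index of [t O] serves as the chain condition whenever an extremal ideal is
    chosen. *)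

Definition subgroup (V : zmodType) (A : set V) : Prop :=
  A 0 /\ forall x y, A x -> A y -> A (x - y).

Section Subgroup.
Variables (V : zmodType) (A : set V) (sA : subgroup A).

Lemma subgroup0 : A 0. Proof. by case: sA. Qed.
Lemma subgroupB x y : A x -> A y -> A (x - y).
Proof. by case: sA => _; apply. Qed.
Lemma subgroupN x : A x -> A (- x).
Proof. by move=> Ax; rewrite -sub0r; apply: subgroupB => //; exact: subgroup0. Qed.
Lemma subgroupD x y : A x -> A y -> A (x + y).
Proof. by move=> Ax Ay; rewrite -[y]opprK; apply/subgroupB/subgroupN. Qed.
Lemma subgroup_sum (I : Type) (s : seq I) (P : pred I) (F : I -> V) :
  (forall i, P i -> A (F i)) -> A (\sum_(i <- s | P i) F i).
Proof.
by move=> AF; apply: (big_ind A) => //; [exact: subgroup0 | exact: subgroupD].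
Qed.
End Subgroup.

Definition transversal (V : zmodType) (A B : set V) (T : Type) (r : T -> V) :=
  [/\ forall i, A (r i), forall x, A x -> exists i, B (x - r i)
    & forall i j, B (r i - r j) -> i = j].

(** A relation carrying representatives: finiteness is part of it and no quotient group is formed.
    [B] need not lie in [A]; for subgroups the number is the index of their intersection in [A]. *)
Definition has_index (V : zmodType) (A B : set V) (n : nat) :=
  exists r : 'I_n -> V, transversal A B r.

Section Index.
Variable V : zmodType.
Implicit Types A B C : set V.

Lemma transversal_index (T : finType) A B (r : T -> V) :
  transversal A B r -> has_index A B #|T|.
Proof.
move=> [Ar cov inj]; exists (fun i => r (enum_val i)); split=> //.
  by move=> x /cov[i Bi]; exists (enum_rank i); rewrite enum_rankK.
by move=> i j /inj/enum_val_inj.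
Qed.

(** Two packed elements covered by the same class are congruent modulo [B], hence equal. The [c i]
    may lie outside [A], so a cover of a group also serves its subgroups. *)
Lemma leq_packing_cover (S T : finType) A B (r : S -> V) (c : T -> V) :
  subgroup B -> (forall i, A (r i)) -> (forall i j, B (r i - r j) -> i = j) ->
  (forall x, A x -> exists i, B (x - c i)) -> (#|S| <= #|T|)%N.
Proof.
move=> sB Ar inj cov.
have [f fP] := choice (fun i => cov (r i) (Ar i)).
apply: (@leq_card _ _ f) => i j eqf; apply: inj.
have -> : r i - r j = (r i - c (f i)) - (r j - c (f j)) by rewrite eqf opprB addrA subrK.
exact: subgroupB.
Qed.

Lemma has_index_uniq A B m n :
  subgroup B -> has_index A B m -> has_index A B n -> m = n.
Proof.
move=> sB [r [Ar cov inj]] [r' [Ar' cov' inj']].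
have := leq_packing_cover sB Ar inj cov'; have := leq_packing_cover sB Ar' inj' cov.
by rewrite !card_ord => h1 h2; apply/eqP; rewrite eqn_leq h1 h2.
Qed.

Lemma has_index_gt0 A B n : subgroup A -> has_index A B n -> (0 < n)%N.
Proof.
by move=> sA [r [_ cov _]]; have [i _] := cov 0 (subgroup0 sA); case: n i r cov => // -[].
Qed.

Lemma has_index1 A B : subgroup A -> A `<=` B -> has_index A B 1.
Proof.
move=> sA AB; exists (fun=> 0); split=> [_|x Ax|i j _].
- exact: subgroup0.
- by exists ord0; rewrite subr0; exact: AB.
- by rewrite !ord1.
Qed.

Lemma has_index1_sub A B : subgroup A -> subgroup B ->
  has_index A B 1 -> A `<=` B.
Proof.
move=> sA sB [r [_ cov _]] x Ax.
have [i Bi] := cov _ Ax; have [j Bj] := cov _ (subgroup0 sA).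
by move: Bi Bj; rewrite !ord1 => Bi Bj; have := subgroupB sB Bi Bj;
  rewrite sub0r opprK subrK.
Qed.

(** A packing of maximal size, bounded by the cover, is a transversal: an element that it misses
    could be added to it. *)
Lemma cover_has_index (T : finType) A B (c : T -> V) :
  subgroup B -> (forall x, A x -> exists i, B (x - c i)) ->
  exists2 n, has_index A B n & (n <= #|T|)%N.
Proof.
move=> sB cov.
pose P n := `[< exists r : 'I_n -> V, (forall i, A (r i)) /\
   (forall i j, B (r i - r j) -> i = j) >].
have P0 : exists n, P n.
  by exists 0%N; apply/asboolP; exists (fun=> 0); split=> -[].
have Pub n : P n -> (n <= #|T|)%N.
  move=> /asboolP[r [Ar inj]]; rewrite -[n]card_ord.
  exact: leq_packing_cover sB Ar inj cov.
case: (ex_maxnP P0 Pub) => n Pn nmax; exists n; last exact: Pub.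
move: Pn => /asboolP[r [Ar inj]]; exists r; split=> // x Ax.
apply: contrapT => /forallNP noi.
suff : P n.+1 by move/nmax; rewrite ltnn.
apply/asboolP; exists (fun i => oapp r x (unlift ord0 i)).
split=> [i|i j]; first by case: (unlift ord0 i).
case: unliftP => [i'|] ->; case: unliftP => [j'|] -> //=.
- by move/inj->.
- by move=> /(subgroupN sB); rewrite opprB => /noi.
- by move/noi.
Qed.

Lemma has_index_mul A B C m n : subgroup A -> subgroup B ->
  C `<=` B -> B `<=` A ->
  has_index A B m -> has_index B C n -> has_index A C (m * n).
Proof.
move=> sA sB CB BA [r [Ar cov inj]] [s [Bs cov' inj']].
suff: has_index A C #|{: 'I_m * 'I_n}| by rewrite card_prod !card_ord.
apply: (@transversal_index _ _ _ (fun p => r p.1 + s p.2)); split.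
- by case=> i j; apply: subgroupD => //; apply: BA.
- move=> x /cov[i /cov'[j Cij]]; exists (i, j) => /=.
  by rewrite opprD addrA.
- move=> [i j] [i' j'] /= Cij.
  have eqi : i = i'.
    apply: inj; have -> : r i - r i' = (r i + s j - (r i' + s j')) - (s j - s j').
      by rewrite opprD addrACA addrK.
    by apply: subgroupB => //; [exact: CB | exact: subgroupB].
  move: Cij; rewrite -eqi => Cij; congr pair; apply: inj'.
  by move: Cij; rewrite opprD addrACA subrr add0r.
Qed.

(** Representatives of [A] modulo [C] cover both [A] modulo [B] and [B] modulo [C], so both indices
    are finite. *)
Lemma has_index_tower A B C n : subgroup B -> subgroup C -> subgroup A ->
  C `<=` B -> B `<=` A -> has_index A C n ->
  exists m k, [/\ has_index A B m, has_index B C k & n = (m * k)%N].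
Proof.
move=> sB sC sA CB BA AC; have [r [Ar cov inj]] := AC.
have [m ABm _] : exists2 m, has_index A B m & (m <= #|'I_n|)%N.
  apply: (@cover_has_index _ A B r) => // x /cov[i Ci].
  by exists i; apply: CB.
have [k BCk _] : exists2 m, has_index B C m & (m <= #|'I_n|)%N.
  by apply: (@cover_has_index _ B C r) => // x /BA/cov.
exists m, k; split=> //; apply: has_index_uniq AC _ => //.
exact: has_index_mul ABm BCk.
Qed.

End Index.

Lemma has_index_image (V W : zmodType) (f : V -> W) (A B : set V) n :
  {morph f : x y / x - y} -> injective f ->
  has_index A B n -> has_index (f @` A) (f @` B) n.
Proof.
move=> fB finj [r [Ar cov inj]]; exists (f \o r); split=> /=.
- by move=> i; exists (r i).
- by move=> _ [x Ax <-]; have [i Bi] := cov x Ax; exists i; exists (x - r i).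
- by move=> i j [z Bz]; rewrite -fB => /finj zE; apply: inj; rewrite -zE.
Qed.

Lemma subgroup_image (V W : zmodType) (f : V -> W) (A : set V) :
  {morph f : x y / x - y} -> subgroup A -> subgroup (f @` A).
Proof.
move=> fB sA; split.
  exists (0 - 0); last by rewrite fB subrr.
  by apply: subgroupB => //; exact: subgroup0.
by move=> _ _ [x Ax <-] [y Ay <-]; exists (x - y) => //; exact: subgroupB.
Qed.

(** * Scalar multiples of subgroups of a field *)

Section Dilation.
Variable K : fieldType.
Implicit Types (A B : set K) (t : K).

Definition dilate t A : set K := [set t * x | x in A].

Lemma subgroup_dilate t A : subgroup A -> subgroup (dilate t A).
Proof. by apply: subgroup_image => x y; rewrite mulrBr. Qed.

Lemma has_index_dilate t A B n : t != 0 ->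
  has_index A B n -> has_index (dilate t A) (dilate t B) n.
Proof.
move=> t0; apply: has_index_image; last exact: mulfI.
by move=> x y; rewrite mulrBr.
Qed.

Lemma dilateM t u A : dilate t (dilate u A) = dilate (t * u) A.
Proof.
rewrite /dilate eqEsubset; split=> [_ [_ [x Ax <-] <-]|_ [x Ax <-]].
  by exists x; rewrite // mulrA.
by exists (u * x); [exists x | rewrite mulrA].
Qed.

Lemma dilate1 A : dilate 1 A = A.
Proof.
rewrite /dilate eqEsubset; split=> [_ [x Ax <-]|x Ax]; first by rewrite mul1r.
by exists x; rewrite ?mul1r.
Qed.

Lemma dilateS t A B : A `<=` B -> dilate t A `<=` dilate t B.
Proof. by move=> AB _ [x Ax <-]; exists x => //; exact: AB. Qed.

Lemma has_index_dilateK t A B n : t != 0 ->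
  has_index (dilate t A) (dilate t B) n -> has_index A B n.
Proof.
move=> t0 /(has_index_dilate (invr_neq0 t0)).
by rewrite !dilateM mulVf // !dilate1.
Qed.

End Dilation.

Lemma has_index_ideal_norm (K : fieldExtType rat) (J : set K) n :
  subgroup J -> has_index (@ring_int K) J n -> ideal_norm J = n.
Proof.
move=> sJ [r [Or cov inj]]; rewrite /ideal_norm.
pose g x : set K := [set x + y | y in J].
have gE x y : J (x - y) -> g x = g y.
  move=> Jxy; rewrite /g eqEsubset; split=> _ [z Jz <-].
    by exists ((x - y) + z); [exact: subgroupD | rewrite addrA [y + _]addrC subrK].
  exists (z - (x - y)); first exact: subgroupB.
  by rewrite opprB addrCA [x + _]addrC subrK addrC.
have -> : [set g x | x in @ring_int K] = [set g (r i) | i in [set: 'I_n]].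
  rewrite eqEsubset; split=> [_ [x /cov[i Ji] <-]|_ [i _ <-]]; last by exists (r i).
  by exists i => //; apply/esym/gE.
rewrite fset_set_image; last exact: finite_finset.
rewrite card_imfset /=.
  have -> : fset_set [set: 'I_n] = [fset i | i in 'I_n]%fset.
    apply/fsetP => i; rewrite in_fset_set; last exact: finite_finset.
    by rewrite in_setT !inE.
  by rewrite card_imfset //= size_enum_ord.
move=> i j gij; apply: inj.
have : g (r i) (r i) by exists 0; [exact: subgroup0 | rewrite addr0].
by rewrite gij => -[z Jz <-]; rewrite addrC addKr.
Qed.

(** * The index of the image of an integer matrix *)

Lemma foldr_muln (s : seq nat) : foldr muln 1%N s = (\prod_(i <- s) i)%N.
Proof. by rewrite unlock. Qed.

(** The representatives are the vectors of remainders, counted by a dependent product of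
    ordinals. *)
Lemma has_index_diag n (e : 'I_n -> int) : (forall i, e i != 0) ->
  has_index [set: 'rV[int]_n] [set x : 'rV[int]_n | forall i, (e i %| x ord0 i)%Z]
    (\prod_i absz (e i))%N.
Proof.
move=> e0.
have -> : (\prod_i absz (e i))%N = #|{dffun forall i : 'I_n, 'I_(absz (e i))}|.
  rewrite card_dep_ffun foldr_muln big_map big_enum /=.
  by apply: eq_bigr => i _; rewrite card_ord.
have lt_mod i (x : int) : (absz (x %% e i)%Z < absz (e i))%N.
  by rewrite -ltz_nat gez0_abs ?modz_ge0 // ltz_mod.
pose r (f : {dffun forall i : 'I_n, 'I_(absz (e i))}) : 'rV[int]_n :=
  \row_i (nat_of_ord (f i))%:Z.
apply: (@transversal_index _ _ _ _ r); split=> //=.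
  move=> x _; exists [ffun i => Ordinal (lt_mod i (x 0 i))] => i.
  rewrite !mxE ffunE /= gez0_abs ?modz_ge0 //.
  by rewrite {1}(divz_eq (x 0 i) (e i)) addrK dvdz_mull.
move=> f g efg; apply/ffunP => i; apply/val_inj => /=.
have := efg i; rewrite !mxE -eqz_mod_dvd.
by rewrite -modz_abs -[RHS in _ == RHS]modz_abs !modz_small ?lez_nat ?ltz_nat ?ltn_ord //=
  => /eqP[].
Qed.

Lemma absz_unit (x : int) : x \is a GRing.unit -> absz x = 1%N.
Proof. by rewrite unfold_in => /orP[]/eqP->. Qed.

(** In the Smith normal form the unimodular factor [L] is absorbed by the source and [R] is an
    automorphism of the lattice; the diagonal case remains. *)
Lemma has_index_mulmx n (A : 'M[int]_n) : \det A != 0 ->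
  has_index [set: 'rV[int]_n] [set u *m A | u in [set: 'rV[int]_n]] (absz (\det A)).
Proof.
have [L uL [R uR [e _ ->]]] := int_Smith_normal_form A.
set D := \matrix_(i, j) _.
have DE : D = diag_mx (\row_i e`_i).
  by apply/matrixP => i j; rewrite !mxE.
have detD : \det D = \prod_(i < n) e`_i.
  by rewrite DE det_diag; apply: eq_bigr => i _; rewrite mxE.
rewrite !det_mulmx !abszM (absz_unit uL) (absz_unit uR) mul1n muln1 => det0.
have e0 (i : 'I_n) : e`_i != 0.
  apply: contraNneq det0 => ei0; rewrite detD (bigD1 i) //= ei0.
  by rewrite !(mul0r, mulr0).
have -> : [set u *m (L *m D *m R) | u in [set: 'rV[int]_n]] =
    mulmxr R @` [set x : 'rV[int]_n | forall i, (e`_(nat_of_ord i) %| x ord0 i)%Z].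
  rewrite eqEsubset; split=> [_ [u _ <-]|_ [x xe <-]].
    exists (u *m L *m D); last by rewrite /= !mulmxA.
    by move=> i; rewrite DE mul_mx_diag !mxE dvdz_mull.
  pose y : 'rV[int]_n := \row_i (x ord0 i %/ e`_(nat_of_ord i))%Z.
  exists (y *m invmx L) => //=; rewrite !mulmxA mulmxKV //; congr (_ *m _).
  apply/rowP => i; rewrite DE mul_mx_diag !mxE ord1.
  by apply/eqP; rewrite -dvdz_eq; exact: xe.
have -> : [set: 'rV[int]_n] = mulmxr R @` [set: 'rV[int]_n].
  rewrite eqEsubset; split=> // x _; exists (x *m invmx R) => //=.
  by rewrite mulmxKV.
apply: has_index_image; first by move=> x y /=; rewrite mulmxBl.
  by move=> x y /= /(canRL (mulmxK uR)); rewrite mulmxK.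
rewrite detD (big_morph absz abszM (erefl : absz 1%R = 1%N)).
exact: has_index_diag.
Qed.

(** * Embeddings of a number field *)

Lemma number_field_generator (K : fieldExtType rat) :
  exists (theta : K) (p : {poly rat}),
  [/\ p \is monic, size p = (\dim {:K}).+1 & separable_poly p] /\
  [/\ (map_poly (in_alg K) p).[theta] = 0,
    (forall g : {poly rat}, (map_poly (in_alg K) g).[theta] = 0 -> p %| g)
    & (forall x : K, exists2 g : {poly rat}, (size g <= \dim {:K})%N &
         x = (map_poly (in_alg K) g).[theta])].
Proof.
have sepK (x : K) : separable_element 1 x.
  by apply: pcharf0_separable => q; rewrite (pchar_lalg K) pchar_num.
pose theta := separable_generator 1 {:K}.
have defK : {:K}%VS = <<1; theta>>%VS.
  by apply: eq_adjoin_separable_generator; [apply/separableP => x _ | exact: sub1v].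
have [p pE] := polyOver1P (minPolyOver 1 theta).
have dE : adjoin_degree 1 theta = \dim {:K}.
  by rewrite defK dim_Fadjoin dimv1 muln1.
exists theta, p; split; split.
- by rewrite -(map_monic (in_alg K)) -pE monic_minPoly.
- by rewrite -(size_map_poly (in_alg K)) -pE size_minPoly dE.
- by rewrite -(separable_map (in_alg K)) -pE; exact: sepK.
- by rewrite -pE minPolyxx.
- move=> g g0; rewrite -(dvdp_map (in_alg K)) -pE; apply: minPoly_dvdp.
    by apply/polyOver1P; exists g.
  exact/rootP.
- move=> x; have /Fadjoin_poly_eq xE : x \in <<1; theta>>%VS by rewrite -defK memvf.
  have [g gE] := polyOver1P (Fadjoin_polyOver 1 theta x).
  exists g; last by rewrite -gE xE.
  by rewrite -(size_map_poly (in_alg K)) -gE -dE size_Fadjoin_poly.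
Qed.

Section Embeddings.
Variables (K : fieldExtType rat) (C : numClosedFieldType).
Variables (theta : K) (p : {poly rat}).
Hypothesis p_min : forall g : {poly rat}, (map_poly (in_alg K) g).[theta] = 0 -> p %| g.
Hypothesis theta_gen : forall x : K, exists g : {poly rat},
  x = (map_poly (in_alg K) g).[theta].

Lemma rmorph_horner_alg (s : {rmorphism K -> C}) (g : {poly rat}) (x : K) :
  s (map_poly (in_alg K) g).[x] = (map_poly ratr g).[s x].
Proof.
rewrite -horner_map -map_poly_comp; congr (_ .[ _ ]).
by apply: eq_map_poly => c; rewrite /= rmorphZ_num rmorph1 mulr1.
Qed.

(** The embedding evaluates at [r] a chosen polynomial that represents [x] at [theta]; two such
    polynomials differ by a multiple of [p], so the choice does not matter. *)
Lemma embedding_of_root (r : C) : root (map_poly ratr p) r ->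
  exists s : {rmorphism K -> C}, s theta = r.
Proof.
move=> /rootP pr; have [f fE] := choice theta_gen.
pose s x := (map_poly ratr (f x)).[r].
have sE g : s (map_poly (in_alg K) g).[theta] = (map_poly ratr g).[r].
  apply/eqP; rewrite -subr_eq0 -hornerN -hornerD -rmorphB.
  have /dvdpP[q ->] : p %| f (map_poly (in_alg K) g).[theta] - g.
    by apply: p_min; rewrite rmorphB hornerD hornerN -fE subrr.
  by rewrite rmorphM hornerM pr mulr0.
have sB : zmod_morphism s.
  move=> x y; rewrite {1}(fE x) {1}(fE y) -hornerN -hornerD -rmorphB sE.
  by rewrite rmorphB hornerD hornerN.
have sM : monoid_morphism s.
  split=> [|x y].
    by have := sE 1; rewrite !rmorph1 !hornerC.
  by rewrite {1}(fE x) {1}(fE y) -hornerM -rmorphM sE rmorphM hornerM.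
pose hB := GRing.isZmodMorphism.Build _ _ s sB.
pose hM := GRing.isMonoidMorphism.Build _ _ s sM.
pose h : {rmorphism _ -> _} := HB.pack s hB hM.
exists h; change (s theta = r).
by have := sE 'X; rewrite !map_polyX !hornerX.
Qed.
End Embeddings.

(* The Vandermonde matrix of the conjugates of [theta] diagonalizes multiplication by [t]. *)
Lemma embeddings_power_basis (K : fieldExtType rat) (C : numClosedFieldType) :
  exists (theta : K) (s : 'I_(\dim {:K}) -> {rmorphism K -> C}),
  [/\ forall i j, s i =1 s j -> i = j,
      forall sigma : {rmorphism K -> C}, exists i, sigma =1 s i,
      forall x : K, exists c : 'rV[rat]_(\dim {:K}),
        x = \sum_i c ord0 i *: theta ^+ i,
      forall c : 'rV[rat]_(\dim {:K}), \sum_i c ord0 i *: theta ^+ i = 0 -> c = 0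
    & forall (A : 'M[rat]_(\dim {:K})) (t : K),
        (forall i : 'I_(\dim {:K}), t * theta ^+ i = \sum_j A i j *: theta ^+ j) ->
        ratr (\det A) = \prod_i s i t].
Proof.
have [theta [p [[pm szp sepp] [p0 pmin gen]]]] := number_field_generator K.
set d := \dim {:K} in szp gen *.
have gen' x : exists g : {poly rat}, x = (map_poly (in_alg K) g).[theta].
  by have [g _ ->] := gen x; exists g.
have [r rE] := closed_field_poly_normal (map_poly (ratr : rat -> C) p).
rewrite (monicP _) ?map_monic // scale1r in rE.
have ur : uniq r.
  by rewrite -separable_prod_XsubC -rE separable_map.
have szr : size r = d.
  by apply/eqP; rewrite -eqSS -(size_prod_XsubC r id) -rE size_map_poly szp.
have root_r (x : C) : root (map_poly ratr p) x = (x \in r).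
  by rewrite rE root_prod_XsubC.
have rP (i : 'I_d) : exists s : {rmorphism K -> C}, s theta = r`_i.
  by apply: (embedding_of_root pmin gen'); rewrite root_r mem_nth // szr.
have [s sE] := choice rP.
have eq_s (f g : {rmorphism K -> C}) : f theta = g theta -> f =1 g.
  by move=> fg x; have [h ->] := gen' x; rewrite !rmorph_horner_alg fg.
have inj i j : s i theta = s j theta -> i = j.
  rewrite !sE => /eqP; rewrite nth_uniq ?szr // => /eqP eij.
  exact: val_inj.
have hornerE (g : {poly rat}) : (size g <= d)%N ->
    (map_poly (in_alg K) g).[theta] = \sum_(i < d) g`_i *: theta ^+ i.
  move=> szg; rewrite (@horner_coef_wide _ d) ?size_map_poly //.
  by apply: eq_bigr => i _; rewrite coef_map mulr_algl.
exists theta, s; split.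
- by move=> i j eq_ij; apply: inj.
- move=> sigma.
  have : sigma theta \in r.
    rewrite -root_r; apply/rootP.
    by rewrite -(rmorph_horner_alg sigma) p0 rmorph0.
  move=> rs; have lid : (index (sigma theta) r < d)%N by rewrite -szr index_mem.
  by exists (Ordinal lid); apply: eq_s; rewrite sE nth_index.
- move=> x; have [g szg ->] := gen x; exists (\row_i g`_i).
  by rewrite hornerE //; apply: eq_bigr => i _; rewrite mxE.
- move=> c c0; have szg : (size (rVpoly c) <= d)%N by exact: size_poly.
  have : p %| rVpoly c.
    apply: pmin; rewrite hornerE // -[RHS]c0; apply: eq_bigr => i _.
    by rewrite coef_rVpoly_ord.
  move=> pc; have [g0|/eqP g0] := eqVneq (rVpoly c) 0.
    by rewrite -[c]rVpolyK g0 linear0.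
  have := dvdp_leq (introN eqP g0) pc; rewrite szp => h.
  by have := leq_trans h szg; rewrite ltnn.
- move=> A t tA.
  pose v := \row_i s i theta; pose V := Vandermonde d v.
  have AV : map_mx ratr A *m V = V *m diag_mx (\row_i s i t).
    apply/matrixP => i k; rewrite mul_mx_diag !mxE mulrC -[s k theta ^+ i]rmorphXn -rmorphM.
    rewrite tA rmorph_sum; apply: eq_bigr => j _.
    by rewrite !mxE rmorphZ_num rmorphXn.
  have Vn0 : \det V != 0.
    rewrite det_Vandermonde; apply/prodf_neq0 => i _; apply/prodf_neq0 => j lij.
    rewrite !mxE subr_eq0; apply: contraTneq lij => /inj->.
    by rewrite ltnn.
  have := congr1 determinant AV; rewrite !det_mulmx det_map_mx det_diag mulrC.
  move/(mulfI Vn0)->; apply: eq_bigr => i _; by rewrite mxE.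
Qed.

(** * The index of a principal ideal *)

Lemma common_denominator (T : finType) (c : T -> rat) :
  exists2 m : int, m != 0 & forall i, exists z : int, m%:~R * c i = z%:~R.
Proof.
exists (\prod_i denq (c i)); first by apply/prodf_neq0 => i _; exact: denq_neq0.
move=> i; exists (numq (c i) * \prod_(j | j != i) denq (c j)).
by rewrite (bigD1 i) //= !rmorphM /= mulrC mulrA -numqE.
Qed.

Section RingOfIntegers.
Variable K : fieldExtType rat.
Local Notation O := (@ring_int K).

Lemma ring_intB x y : O x -> O y -> O (x - y).
Proof. exact: integral_sub. Qed.
Lemma ring_intM x y : O x -> O y -> O (x * y).
Proof. exact: integral_mul. Qed.
Lemma ring_int0 : O 0. Proof. exact: integral0. Qed.
Lemma ring_int1 : O 1. Proof. exact: integral1. Qed.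
Lemma ring_int_intr (n : int) : O n%:~R.
Proof. exact: integral_id. Qed.
Lemma ring_int_subgroup : subgroup O.
Proof. by split; [exact: ring_int0 | exact: ring_intB]. Qed.
Lemma ring_intX x n : O x -> O (x ^+ n).
Proof.
move=> Ox; elim: n => [|n IH]; rewrite ?expr0 ?exprS; first exact: ring_int1.
exact: ring_intM.
Qed.

Lemma intr_neq0 (m : int) : m != 0 -> m%:~R != 0 :> K.
Proof. by rewrite -(rmorph_int (in_alg K)) fmorph_eq0 intr_eq0. Qed.

Lemma rat_scale_int (m z : int) (c : rat) (x : K) :
  m%:~R * c = z%:~R -> m%:~R * (c *: x) = z%:~R * x.
Proof.
move=> /(congr1 (in_alg K)); rewrite rmorphM !rmorph_int /= => e.
by rewrite -(mulr_algl c x) mulrA e.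
Qed.

Section PowerBasis.
Variables (d : nat) (theta : K).
Hypothesis theta_span : forall x : K, exists c : 'rV[rat]_d,
  x = \sum_i c ord0 i *: theta ^+ i.
Hypothesis theta_free : forall c : 'rV[rat]_d,
  \sum_i c ord0 i *: theta ^+ i = 0 -> c = 0.

(** [theta] need not be integral, so the lattice [M] of these values is in general neither a ring
    nor contained in the ring of integers; hence the scalings by integers below. *)
Definition int_comb (u : 'rV[int]_d) : K := \sum_i (u ord0 i)%:~R * theta ^+ i.
Local Notation M := (int_comb @` [set: 'rV[int]_d]).

Lemma int_combB : {morph int_comb : u v / u - v}.
Proof.
move=> u v; rewrite /int_comb -sumrB; apply: eq_bigr => i _.
by rewrite !mxE rmorphB mulrBl.
Qed.

Lemma int_comb_inj : injective int_comb.
Proof.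
move=> u v /eqP; rewrite -subr_eq0 -int_combB => /eqP uv0.
have : map_mx intr (u - v) = 0 :> 'rV[rat]_d.
  apply: theta_free; rewrite -[RHS]uv0; apply: eq_bigr => i _.
  by rewrite mxE -(rmorph_int (in_alg K)) mulr_algl.
move=> /rowP e; apply/eqP; rewrite -subr_eq0; apply/eqP/rowP => i.
by have := e i; rewrite !mxE => /eqP; rewrite intr_eq0 => /eqP.
Qed.

Lemma int_matrix (t : K) : exists2 m : int, m != 0 &
  exists A : 'M[int]_d, forall i : 'I_d,
    m%:~R * t * theta ^+ i = \sum_j (A i j)%:~R * theta ^+ j.
Proof.
have [c cE] := choice (fun i : 'I_d => theta_span (t * theta ^+ i)).
have [m m0 mP] := common_denominator (fun p : 'I_d * 'I_d => c p.1 ord0 p.2).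
have [z zE] := choice mP; exists m => //; exists (\matrix_(i, j) z (i, j)) => i.
rewrite -mulrA cE mulr_sumr; apply: eq_bigr => j _.
by rewrite mxE; apply: rat_scale_int; exact: (zE (i, j)).
Qed.

Section Mult.
Variables (t : K) (A : 'M[int]_d).
Hypothesis tA : forall i : 'I_d, t * theta ^+ i = \sum_j (A i j)%:~R * theta ^+ j.

Lemma mul_int_comb u : t * int_comb u = int_comb (u *m A).
Proof.
rewrite /int_comb mulr_sumr.
under eq_bigr => i _ do rewrite mulrCA tA mulr_sumr.
rewrite exchange_big; apply: eq_bigr => j _.
rewrite mxE rmorph_sum mulr_suml; apply: eq_bigr => i _.
by rewrite rmorphM mulrA.
Qed.

Lemma dilate_int_comb_sub : dilate t M `<=` M.
Proof. by move=> _ [_ [u _ <-] <-]; exists (u *m A) => //; rewrite mul_int_comb. Qed.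

Lemma det_mult_neq0 : t != 0 -> \det A != 0.
Proof.
move=> t0; apply/eqP => /eqP/det0P[v v0 vA].
have := mul_int_comb v; rewrite vA => /eqP.
have z0 : int_comb 0 = 0 by rewrite -(subrr 0) int_combB subrr.
rewrite z0 mulf_eq0 (negbTE t0) /= -z0 => /eqP/int_comb_inj v00.
by rewrite v00 eqxx in v0.
Qed.

Lemma has_index_int_comb : t != 0 -> has_index M (dilate t M) (absz (\det A)).
Proof.
move=> /det_mult_neq0/has_index_mulmx.
move=> /(has_index_image int_combB int_comb_inj).
suff -> : dilate t M = int_comb @` [set u *m A | u in [set: 'rV[int]_d]] by [].
rewrite eqEsubset; split=> [_ [_ [u _ <-] <-]|_ [_ [u _ <-] <-]].
  by rewrite mul_int_comb; exists (u *m A) => //; exists u.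
by rewrite -mul_int_comb; exists (int_comb u) => //; exists u.
Qed.

(* [t] is an eigenvalue of [A], with eigenvector the powers of [theta]. *)
Lemma mult_int_matrix_integral : (0 < d)%N -> O t.
Proof.
move=> d0; exists (char_poly A^T); first exact: char_poly_monic.
rewrite map_char_poly -eigenvalue_root_char.
apply/eigenvalueP; exists (\row_i theta ^+ i).
  apply/rowP => i; rewrite !mxE tA; apply: eq_bigr => j _.
  by rewrite !mxE mulrC.
apply/eqP => /rowP/(_ (Ordinal d0)); rewrite !mxE expr0 => /eqP.
by rewrite oner_eq0.
Qed.
End Mult.

Lemma scalar_int_matrix (m : int) (i : 'I_d) :
  m%:~R * theta ^+ i = \sum_j ((m%:M : 'M[int]_d) i j)%:~R * theta ^+ j.
Proof.
rewrite (bigD1 i) //= big1 ?addr0 => [|j ji]; rewrite mxE ?eqxx ?mulr1n //.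
by rewrite eq_sym (negbTE ji) mulr0n mul0r.
Qed.

Hypothesis d_gt0 : (0 < d)%N.
Hypothesis O_fg : exists n (e : 'I_n -> K),
  forall x, O x -> exists c : 'I_n -> int, x = \sum_i (c i)%:~R * e i.

Lemma integral_multiple (x : K) : exists2 m : int, m != 0 & O (m%:~R * x).
Proof.
have [m m0 [A tA]] := int_matrix x; exists m => //.
exact: mult_int_matrix_integral tA d_gt0.
Qed.

Lemma int_comb_subgroup : subgroup M.
Proof. by apply: subgroup_image; [exact: int_combB | split]. Qed.

Lemma int_comb_sub_ring_int : exists2 m : int, m != 0 & dilate m%:~R M `<=` O.
Proof.
have mO (i : 'I_d) : exists m : int, m != 0 /\ O (m%:~R * theta ^+ i).
  by have [m m0 mi] := integral_multiple (theta ^+ i); exists m.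
have [m mP] := choice mO.
exists (\prod_i m i); first by apply/prodf_neq0 => i _; case: (mP i).
move=> _ [_ [u _ <-] <-]; rewrite /int_comb mulr_sumr.
apply: subgroup_sum => [|i _]; first exact: ring_int_subgroup.
rewrite (bigD1 i) //= mulrC rmorphM /= [_ * (\prod_(j | _) _)%:~R]mulrC mulrACA.
rewrite -rmorphM mulrC; apply: ring_intM; last exact: ring_int_intr.
by rewrite mulrC; case: (mP i).
Qed.

Lemma ring_int_sub_int_comb : exists2 m : int, m != 0 & dilate m%:~R O `<=` M.
Proof.
have [n [e eP]] := O_fg.
have [c cE] := choice (fun j => theta_span (e j)).
have [m m0 mP] := common_denominator (fun p : 'I_n * 'I_d => c p.1 ord0 p.2).
have [z zE] := choice mP; exists m => // _ [x /eP[a ->] <-].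
exists (\row_i \sum_j a j * z (j, i)) => //.
rewrite /int_comb mulr_sumr; under eq_bigr => i _ do rewrite mxE rmorph_sum mulr_suml.
rewrite exchange_big; apply: eq_bigr => j _.
rewrite mulrCA (cE j) mulr_sumr mulr_sumr; apply: eq_bigr => i _.
by rewrite (rat_scale_int _ (zE (j, i))) rmorphM mulrA.
Qed.

(** With [l O] inside [M] and [m M] inside [O], the group [l O] lies between [M] and [l m M], whose
    index is finite by the determinant of the scalar [l m]. Dividing the lower step by [l] gives the
    claim. *)
Lemma has_index_ring_int_int_comb :
  exists m k, [/\ m%:~R != 0 :> K, dilate m%:~R M `<=` O, (0 < k)%N
    & has_index O (dilate m%:~R M) k].
Proof.
have [m m0 mM] := int_comb_sub_ring_int; have [l l0 lO] := ring_int_sub_int_comb.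
have m0' := intr_neq0 m0; have l0' := intr_neq0 l0; exists m.
have lm0 : (l * m)%:~R != 0 :> K by apply: intr_neq0; rewrite mulf_neq0.
have sM := int_comb_subgroup; have sO := ring_int_subgroup.
have sl := subgroup_dilate l%:~R sO; have slm := subgroup_dilate (l * m)%:~R sM.
have [] := has_index_tower sl slm sM _ lO
   (has_index_int_comb (@scalar_int_matrix (l * m)) lm0).
  by rewrite rmorphM -dilateM; exact: dilateS.
move=> _ [k [_ kl _]]; exists k; split=> //; last first.
  by move: kl; rewrite rmorphM -dilateM; apply: has_index_dilateK.
exact: has_index_gt0 kl.
Qed.

(** The index of [t m M] in [O] is computed through [m M] and through [t O]. Multiplication by [t]
    carries [O] over [m M] to [t O] over [t m M], so these two equal indices cancel. *)
Lemma has_index_ring_int_matrix (t : K) (A : 'M[int]_d) : t != 0 -> O t ->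
  (forall i : 'I_d, t * theta ^+ i = \sum_j (A i j)%:~R * theta ^+ j) ->
  has_index O (dilate t O) (absz (\det A)).
Proof.
move=> t0 Ot tA; have [m [k [m0 mM k0 ki]]] := has_index_ring_int_int_comb.
have sM := int_comb_subgroup; have sO := ring_int_subgroup.
have smM := subgroup_dilate m%:~R sM.
have tOO : dilate t O `<=` O by move=> _ [x Ox <-]; exact: ring_intM.
have stO := subgroup_dilate t sO.
have tmM : dilate t (dilate m%:~R M) `<=` dilate m%:~R M.
  by rewrite dilateM mulrC -dilateM; apply/dilateS/(dilate_int_comb_sub tA).
have stmM := subgroup_dilate t smM.
have h1 : has_index O (dilate t (dilate m%:~R M)) (k * absz (\det A)).
  apply: has_index_mul ki _ => //.
  by rewrite dilateM mulrC -dilateM; apply/has_index_dilate/has_index_int_comb.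
have [] := has_index_tower stO stmM sO (dilateS mM) tOO h1.
move=> N [k' [ON /(has_index_dilateK t0) ki' e]].
rewrite (has_index_uniq smM ki' ki) mulnC in e.
suff -> : absz (\det A) = N by [].
by apply/eqP; rewrite -(eqn_pmul2r k0) e.
Qed.

Lemma has_index_ring_int_intr (m : int) : m != 0 ->
  has_index O (dilate m%:~R O) (absz m ^ d).
Proof.
move=> m0.
have := has_index_ring_int_matrix (intr_neq0 m0) (ring_int_intr m) (@scalar_int_matrix m).
by rewrite det_scalar abszX.
Qed.

(** Even an integral [t] may not preserve the lattice [M], so the determinant is taken for an
    integer multiple [m t]; the factor [m ^ d] cancels against the index of [m O]. *)
Lemma has_index_ring_int (C : numClosedFieldType) (s : 'I_d -> {rmorphism K -> C}) (t : K) :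
  (forall (A : 'M[rat]_d) (t : K),
     (forall i : 'I_d, t * theta ^+ i = \sum_j A i j *: theta ^+ j) ->
     ratr (\det A) = \prod_i s i t) ->
  t != 0 -> O t ->
  exists2 N, has_index O (dilate t O) N & N%:R = \prod_i `|s i t|.
Proof.
move=> det_s t0 Ot; have [m m0 [A tA]] := int_matrix t.
have m0' := intr_neq0 m0.
have hmt := has_index_ring_int_matrix (mulf_neq0 m0' t0)
  (ring_intM (ring_int_intr m) Ot) tA.
have sO := ring_int_subgroup.
have OO u : O u -> dilate u O `<=` O by move=> Ou _ [x Ox <-]; exact: ring_intM.
have [] := has_index_tower (subgroup_dilate m%:~R sO)
  (subgroup_dilate (m%:~R * t) sO) sO _ (OO _ (ring_int_intr m)) hmt.
  by rewrite -dilateM; apply/dilateS/OO.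
move=> N' [N [hm hN e]]; exists N.
  by move: hN; rewrite -dilateM; apply: has_index_dilateK.
rewrite (has_index_uniq (subgroup_dilate m%:~R sO) hm (has_index_ring_int_intr m0)) in e.
have : ratr (\det (map_mx intr A : 'M[rat]_d)) = \prod_i s i (m%:~R * t).
  apply: det_s => i; rewrite tA; apply: eq_bigr => j _.
  by rewrite mxE -(rmorph_int (in_alg K)) mulr_algl.
rewrite det_map_mx ratr_int => /(congr1 Num.norm).
rewrite -intr_norm -abszE e normr_prod.
under eq_bigr => i _ do rewrite rmorphM normrM rmorph_int.
rewrite big_split /= prodr_const card_ord.
rewrite -[RHS]/(_ * _) -intr_norm -abszE.
have mC : (absz m)%:R != 0 :> C by rewrite pnatr_eq0 absz_eq0.
rewrite -!pmulrn natrM natrX => /mulfI; apply.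
by rewrite expf_neq0.
Qed.

End PowerBasis.
End RingOfIntegers.
Arguments ring_int_subgroup {K}.

(** * Ideals of the ring of integers *)

Section Ideals.
Variable K : fieldExtType rat.
Local Notation O := (@ring_int K).
Implicit Types A B I J : set K.

Definition submodule A := subgroup A /\ forall c x, O c -> A x -> A (c * x).

Lemma ring_int_submodule : submodule O.
Proof. by split; [exact: ring_int_subgroup | exact: ring_intM]. Qed.

(** The additive subgroup generated by the products, as an intersection: an additive property of its
    elements is proved by instantiating [S]. *)
Definition ideal_mul A B : set K := [set x | forall S : set K, subgroup S ->
  (forall u v, A u -> B v -> S (u * v)) -> S x].

Definition ideal_inv A : set K := [set x | forall y, A y -> O (y * x)].

Lemma ideal_mul_mem A B u v : A u -> B v -> ideal_mul A B (u * v).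
Proof. by move=> Au Bv S _; apply. Qed.

Lemma ideal_mul_subgroup A B : subgroup (ideal_mul A B).
Proof.
split=> [S [S0 _] _ //|x y xAB yAB S sS SAB].
by apply: subgroupB; [| exact: xAB | exact: yAB].
Qed.

Lemma ideal_mul_submodule A B : submodule A -> submodule (ideal_mul A B).
Proof.
move=> [sA Ac]; split; first exact: ideal_mul_subgroup.
move=> c x Oc /(_ [set z | ideal_mul A B (c * z)]); apply.
  split; first by rewrite /= mulr0; exact: (subgroup0 (ideal_mul_subgroup A B)).
  by move=> u v /= hu hv; rewrite mulrBr; exact: (subgroupB (ideal_mul_subgroup A B)).
by move=> u v Au Bv /=; rewrite mulrA; apply: ideal_mul_mem => //; exact: Ac.
Qed.

Lemma ideal_mulS A B I : A `<=` B -> ideal_mul A I `<=` ideal_mul B I.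
Proof.
move=> AB x xA S sS SB; apply: xA => // u v Au Iv; apply: SB => //; exact: AB.
Qed.

Lemma ideal_mul_sub A I : submodule A -> I `<=` O -> ideal_mul A I `<=` A.
Proof.
move=> [sA Ac] IO x; apply=> // u v Au /IO Ov; rewrite mulrC; exact: Ac.
Qed.

Lemma ideal_mul1 I : submodule I -> ideal_mul O I = I.
Proof.
move=> [sI Ic]; rewrite eqEsubset; split=> x; last first.
  by move=> Ix; rewrite -[x]mul1r; apply: ideal_mul_mem => //; exact: ring_int1.
by apply=> // u v Ou Iv; exact: Ic.
Qed.

(** * Invertibility of ideals from finiteness of principal quotients *)

Section Finite.
Hypothesis finite_index : forall t : K, O t -> t != 0 ->
  exists n, has_index O (dilate t O) n.

Lemma pigeonhole t (f : nat -> K) : O t -> t != 0 -> (forall n, O (f n)) ->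
  exists i j, (j < i)%N /\ dilate t O (f i - f j).
Proof.
move=> Ot t0 Of; have [n [r [_ cov _]]] := finite_index Ot t0.
have [g gP] := choice (fun i : 'I_n.+1 => cov _ (Of i)).
have : ~~ injectiveb g.
  by apply/negP => /injectiveP/leq_card; rewrite !card_ord ltnn.
move=> /injectivePn[i [j ij gij]].
have sD := subgroup_dilate t ring_int_subgroup.
have gB (k l : 'I_n.+1) : g k = g l -> dilate t O (f k - f l).
  move=> gkl; have := subgroupB sD (gP k) (gP l).
  by rewrite gkl opprB addrA subrK.
have [lji|lij|/val_inj e] := ltngtP j i; last by rewrite e eqxx in ij.
  by exists i, j; split=> //; exact: gB.
by exists j, i; split=> //; exact: gB.
Qed.

(* Two powers [x ^ i] and [x ^ j] agree modulo the ring of integers, which makes [x] a root of a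
   monic polynomial. *)
Lemma almost_integral t x : O t -> t != 0 -> (forall n, O (t * x ^+ n)) -> O x.
Proof.
move=> Ot t0 Ox; have [i [j [ji [c Oc]]]] := pigeonhole Ot t0 Ox.
rewrite -mulrBr => /(mulfI t0) cE.
have szq : (size ('X^j + c%:P : {poly K})%R <= i)%N.
  rewrite (leq_trans (size_polyD _ _)) // geq_max size_polyXn ji /=.
  by rewrite (leq_trans (size_polyC_leq1 _)) // (leq_ltn_trans _ ji).
apply: (@integral_root_monic _ _ _ _ ('X^i - ('X^j + c%:P))).
- rewrite monicE lead_coefDl ?lead_coefXn //.
  by rewrite size_polyN size_polyXn ltnS.
- by rewrite rootE !hornerE cE; apply/eqP; ring.
- apply/integral_poly => k; rewrite coefB coefD !coefXn coefC.
  have On (b : bool) : O b%:R by case: b; [exact: ring_int1 | exact: ring_int0].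
  apply: ring_intB => //; apply: subgroupD => //; first exact: ring_int_subgroup.
  by case: ifP => // _; exact: ring_int0.
Qed.

Lemma ideal_has_index t A : submodule A -> A `<=` O -> O t -> t != 0 -> A t ->
  exists n, has_index O A n.
Proof.
move=> [sA Ac] AO Ot t0 At; have [n h] := finite_index Ot t0.
have sD := subgroup_dilate t ring_int_subgroup.
have [] := has_index_tower sA sD ring_int_subgroup _ AO h.
  by move=> _ [x Ox <-]; rewrite mulrC; exact: Ac.
by move=> m [k [hm _ _]]; exists m.
Qed.

Lemma submodule_add_gen A x : submodule A ->
  submodule [set y | exists c z, [/\ O c, A z & y = c * x + z]].
Proof.
move=> [sA Ac]; split; first split.
- by exists 0, 0; split; [exact: ring_int0 | exact: subgroup0 | rewrite mul0r addr0].
- move=> _ _ [c [z [Oc Az ->]]] [c' [z' [Oc' Az' ->]]].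
  exists (c - c'), (z - z'); split; [exact: ring_intB | exact: subgroupB | ring].
- move=> d _ Od [c [z [Oc Az ->]]]; exists (d * c), (d * z).
  by split; [exact: ring_intM | exact: Ac | ring].
Qed.

Lemma has_index_sub_lt A B C m n : subgroup A -> subgroup B -> subgroup C ->
  C `<=` B -> B `<=` A -> ~ (B `<=` C) ->
  has_index A C n -> has_index A B m -> (m < n)%N.
Proof.
move=> sA sB sC CB BA nBC hn hm.
have [m' [k [hm' hk ->]]] := has_index_tower sB sC sA CB BA hn.
rewrite (has_index_uniq sB hm hm') ltn_Pmulr ?(has_index_gt0 sA hm') //.
case: k hk => [|[|//]] hk; first by have := has_index_gt0 sB hk.
by case: nBC; exact: has_index1_sub hk.
Qed.

(** A proper ideal of least index above [A] is chosen. If it contains [r u] but neither factor,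
    adjoining [r] lowers the index, so 1 is reached, and multiplying by [u] puts [u] in [P]. *)
Lemma maximal_ideal A t : submodule A -> A `<=` O -> O t -> t != 0 -> A t -> ~ A 1 ->
  exists P, [/\ submodule P, A `<=` P, P `<=` O, ~ P 1
    & forall r u, O r -> O u -> P (r * u) -> ~ P u -> P r].
Proof.
move=> mA AO Ot t0 At A1.
pose Q n := `[< exists P, [/\ submodule P, A `<=` P, P `<=` O, ~ P 1
   & has_index O P n] >].
have exQ : exists n, Q n.
  have [n h] := ideal_has_index mA AO Ot t0 At.
  by exists n; apply/asboolP; exists A; split.
case: (ex_minnP exQ) => n /asboolP[P [mP AP PO P1 h]] nmin.
exists P; split=> // r u Or Ou Pru nPu; apply: contrapT => nPr.
pose P' : set K := [set y | exists c z, [/\ O c, P z & y = c * r + z]].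
have mP' : submodule P' by exact: submodule_add_gen.
have PP' : P `<=` P'.
  by move=> z Pz; exists 0, z; rewrite mul0r add0r; split=> //; exact: ring_int0.
have P'O : P' `<=` O.
  move=> _ [c [z [Oc /PO Oz ->]]]; apply: (subgroupD ring_int_subgroup) => //.
  exact: ring_intM.
have [[c [z [Oc Pz e]]]|nP'1] := pselect (P' 1).
  apply: nPu; rewrite -[u]mul1r e mulrDl; apply: (subgroupD mP.1).
    by rewrite -mulrA; exact: mP.2.
  by rewrite mulrC; exact: mP.2.
have [n' h'] := ideal_has_index mP' P'O Ot t0 (PP' _ (AP _ At)).
have := nmin n'; rewrite leqNgt (has_index_sub_lt ring_int_subgroup mP'.1 mP.1 PP' P'O _ h h').
  by move=> H; have /H : Q n' by apply/asboolP; exists P'; split=> // y /AP/PP'.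
move=> P'P; apply: nPr; apply: P'P; exists 1, 0; rewrite mul1r addr0.
by split=> //; [exact: ring_int1 | exact: (subgroup0 mP.1)].
Qed.

Definition denominators x : set K := [set r | O r /\ O (r * x)].

Lemma denominators_submodule x : submodule (denominators x).
Proof.
split; first split.
- by rewrite /denominators /= mul0r; split; exact: ring_int0.
- move=> r s [Or Orx] [Os Osx]; split; first exact: ring_intB.
  by rewrite mulrBl; exact: ring_intB.
- move=> c r Oc [Or Orx]; split; first exact: ring_intM.
  by rewrite -mulrA; exact: ring_intM.
Qed.

(* Among the [x] in [t^-1 O] whose denominators lie in the maximal ideal [P], one
   with as many denominators as possible has [P] as its ideal of denominators. *)
Lemma proper_ideal_inv A t : submodule A -> A `<=` O -> O t -> t != 0 -> A t -> ~ A 1 ->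
  exists2 x, ideal_inv A x & ~ O x.
Proof.
move=> mA AO Ot t0 At A1.
have [P [mP AP PO P1 Pprime]] := maximal_ideal mA AO Ot t0 At A1.
pose Q n := `[< exists x, [/\ O (t * x), denominators x `<=` P
   & has_index O (denominators x) n] >].
have dO x : denominators x `<=` O by move=> r [].
have didx x : O (t * x) -> exists n, has_index O (denominators x) n.
  move=> Otx; apply: (ideal_has_index _ _ Ot t0) => //.
  exact: denominators_submodule.
(* [t^-1] qualifies: its denominators are the multiples of [t], which lie in [A]. *)
have exQ : exists n, Q n.
  have [|n h] := didx t^-1; first by rewrite divff //; exact: ring_int1.
  exists n; apply/asboolP; exists t^-1; split=> //.
    by rewrite divff //; exact: ring_int1.
  move=> r [Or Ort]; rewrite -[r](mulfVK t0); apply: mP.2 => //; exact: AP.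
case: (ex_minnP exQ) => n /asboolP[x [Otx dP h]] nmin.
have dmax y : O (t * y) -> denominators y `<=` P -> denominators x `<=` denominators y ->
    denominators y `<=` denominators x.
  move=> Oty dyP dxy; apply: contrapT => ndyx.
  have [n' h'] := didx y Oty.
  have /nmin : Q n' by apply/asboolP; exists y; split.
  rewrite leqNgt (has_index_sub_lt ring_int_subgroup _ _ dxy _ ndyx h h') //.
  - exact: (denominators_submodule y).1.
  - exact: (denominators_submodule x).1.
(* Such an [x] multiplies [A], a part of [P], into the integers, and it is not integral because 1 is
   not among its denominators. *)
suff Px p : P p -> O (p * x).
  exists x; first by move=> y /AP/Px.
  by move=> Ox; apply: P1; apply: dP; rewrite /denominators /= mul1r; split=> //; exact: ring_int1.
move=> Pp; apply: contrapT => nOpx.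
have Op := PO _ Pp.
have dsub s : O s -> denominators x `<=` denominators (s * x).
  move=> Os r [Or Orx]; split=> //; rewrite mulrCA; exact: ring_intM.
have Ots s : O s -> O (t * (s * x)) by move=> Os; rewrite mulrCA; exact: ring_intM.
(* For [s] outside the prime [P] the denominators of [s x] still lie in [P]; by maximality they are
   those of [x], and they contain [p]. *)
have [[s [Os nPs Ospx]]|nos] := pselect (exists s, [/\ O s, ~ P s & O (s * (p * x))]).
  apply: nOpx; suff : denominators x p by case.
  apply: (dmax (s * x)) => //; [exact: Ots | | exact: dsub | ].
    move=> r [Or Orsx]; apply: (Pprime r s) => //; apply: dP; split.
      exact: ring_intM.
    by rewrite -mulrA.
  by split=> //; rewrite mulrCA.
(* Now the denominators of [p x] lie in [P], so by maximality they are those of [x], and factors [p]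
   can be removed one after the other. *)
have inj r : O r -> O (r * (p * x)) -> O (r * x).
  move=> Or Orpx; suff : denominators x r by case.
  apply: (dmax (p * x)) => //; [exact: Ots | | exact: dsub].
  move=> s [Os Ospx]; apply: contrapT => nPs; by apply: nos; exists s.
have injX r i : O r -> O (r * (p ^+ i * x)) -> O (r * x).
  move=> Or; elim: i => [|i IH]; first by rewrite expr0 mul1r.
  move=> H; apply: IH; rewrite mulrA; apply: inj.
    by apply: ring_intM => //; exact: ring_intX.
  by have -> : r * p ^+ i * (p * x) = r * (p ^+ i.+1 * x) by rewrite exprSr !mulrA.
(* Two of these elements agree modulo [t O]; removing the powers of [p] leaves [p ^+ (i - j) - 1]
   among the denominators of [x], hence in [P], although [p] is in [P]. *)
have Opn k : O (p ^+ k * (t * x)) by apply: ring_intM => //; exact: ring_intX.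
have [i [j [ji [c Oc]]]] := pigeonhole Ot t0 Opn.
rewrite -mulrBl mulrCA => /(mulfI t0) cE.
have Ou : O (p ^+ (i - j) - 1).
  by apply: ring_intB; [exact: ring_intX | exact: ring_int1].
have : P (p ^+ (i - j) - 1).
  apply: dP; split=> //; apply: (injX _ j) => //.
  by rewrite mulrA mulrBl mul1r -exprD subnK ?(ltnW ji) // -cE.
have : P (p ^+ (i - j)).
  rewrite -(prednK (_ : (0 < i - j)%N)) ?subn_gt0 // exprSr; apply: mP.2 => //.
  exact: ring_intX.
move=> h1 h2; apply: P1; have := subgroupB mP.1 h1 h2.
by rewrite opprB addrC subrK.
Qed.

(** If the product were a proper ideal, some non-integral [x] would multiply it into [O]. Then [x]
    maps the inverse of [I] into itself, so every [t x ^+ n] is integral, which makes [x]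
    integral. *)
Lemma ideal_mul_inv I t : submodule I -> I `<=` O -> I t -> t != 0 ->
  ideal_mul I (ideal_inv I) 1.
Proof.
move=> mI IO It t0; apply: contrapT => n1.
have Ot := IO _ It.
have inv1 : ideal_inv I 1 by move=> y /IO; rewrite mulr1.
have sub : ideal_mul I (ideal_inv I) `<=` O.
  by move=> x; apply; [exact: ring_int_subgroup | move=> u v Iu; apply].
have At : ideal_mul I (ideal_inv I) t.
  by rewrite -[t]mulr1; exact: ideal_mul_mem.
have [x xA nOx] := proper_ideal_inv (ideal_mul_submodule _ mI) sub Ot t0 At n1.
apply: nOx; apply: (almost_integral Ot t0) => n.
suff /(_ t It) : ideal_inv I (x ^+ n) by [].
elim: n => [|n IH]; first by rewrite expr0.
by move=> y Iy; rewrite exprSr mulrA; apply: xA; exact: ideal_mul_mem.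
Qed.

End Finite.

(** * The effect on the index of multiplying by an invertible ideal *)

Section IndexMul.
Variable I : set K.
Hypothesis I_inv : ideal_mul I (ideal_inv I) 1.

(** Since 1 is a sum of products [u v] with [u] in [I] and [v] in its inverse, [a] is a sum of terms
    [a u v], each of which lies in [B]. *)
Lemma ideal_mul_cancel A B : submodule B ->
  ideal_mul A I `<=` ideal_mul B I -> A `<=` B.
Proof.
move=> [sB Bc] AB a Aa; rewrite -[a]mulr1.
have sub_pre c : subgroup [set w | B (w * c)].
  split=> [|x y hx hy] /=; first by rewrite mul0r; exact: subgroup0.
  by rewrite mulrBl; exact: subgroupB.
suff : [set w | B (a * w)] 1 by [].
apply: I_inv.
  by under eq_set => w do rewrite mulrC; exact: sub_pre.
move=> u v Iu Iv /=; rewrite mulrA.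
have : ideal_mul B I (a * u) by apply: AB; exact: ideal_mul_mem.
move=> /(_ [set w | B (w * v)]); apply=> // b i Bb Ii /=.
by rewrite -mulrA mulrC; apply: Bc => //; exact: Iv.
Qed.

(* The quotient [C / B] below is simple, isomorphic to [O / P] with [P] maximal;
   [C I / B I] is a nonzero [O / P]-vector space. *)
Lemma has_index_mul_ideal A B m n : submodule A -> submodule B -> B `<=` A ->
  has_index A B n -> has_index (ideal_mul A I) (ideal_mul B I) m -> (n <= m)%N.
Proof.
elim/ltn_ind: n A B m => n IH A B m mA mB BA hn hm.
have sAI := ideal_mul_subgroup A I; have sBI := ideal_mul_subgroup B I.
have [AB|nAB] := pselect (A `<=` B).
  by rewrite (has_index_uniq mB.1 hn (has_index1 mA.1 AB)) (has_index_gt0 sAI hm).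
pose G x : set K := [set y | exists c z, [/\ O c, B z & y = c * x + z]].
have mG x : submodule (G x) by exact: submodule_add_gen.
have BG x : B `<=` G x.
  by move=> z Bz; exists 0, z; rewrite mul0r add0r; split=> //; exact: ring_int0.
have GA x : A x -> G x `<=` A.
  move=> Ax _ [c [z [Oc Bz ->]]]; apply: (subgroupD mA.1); [exact: mA.2 | exact: BA].
have Gx x : G x x.
  by exists 1, 0; rewrite mul1r addr0; split=> //; [exact: ring_int1 | exact: (subgroup0 mB.1)].
have Gidx x : A x -> exists k, has_index (G x) B k.
  move=> Ax; have [_ [k [_ hk _]]] :=
    has_index_tower (mG x).1 mB.1 mA.1 (BG x) (GA x Ax) hn.
  by exists k.
pose Q k := `[< exists x, [/\ A x, ~ B x & has_index (G x) B k] >].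
have exQ : exists k, Q k.
  have /existsNP[x /not_implyP[Ax nBx]] := nAB.
  by have [k hk] := Gidx x Ax; exists k; apply/asboolP; exists x; split.
case: (ex_minnP exQ) => k /asboolP[x [Ax nBx hk]] kmin.
have [r [Gr cov inj]] := hk.
have /choice[o oP] : forall i, exists c, O c /\ exists2 z, B z & r i = c * x + z.
  by move=> i; have [c [z [Oc Bz e]]] := Gr i; exists c; split=> //; exists z.
have nGI : ~ (ideal_mul (G x) I `<=` ideal_mul B I).
  by move=> /(ideal_mul_cancel mB)/(_ x (Gx x)).
have /existsNP[y /not_implyP[GIy nBIy]] := nGI.
have GIBI : ideal_mul B I `<=` ideal_mul (G x) I by exact: ideal_mulS.
have GIAI : ideal_mul (G x) I `<=` ideal_mul A I by apply: ideal_mulS; exact: GA.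
have mGI := ideal_mul_submodule I (mG x).
have mBI := ideal_mul_submodule I mB.
have [m1 [m2 [hm1 hm2 ->]]] := has_index_tower mGI.1 sBI sAI GIBI GIAI hm.
have [n1 [n2 [hn1 hn2 nE]]] := has_index_tower (mG x).1 mB.1 mA.1 (BG x) (GA x Ax) hn.
have n2k := has_index_uniq mB.1 hn2 hk; rewrite n2k in nE.
have n1lt : (n1 < n)%N.
  apply: (has_index_sub_lt mA.1 (mG x).1 mB.1 (BG x) (GA x Ax) _ hn hn1).
  by move=> /(_ x (Gx x)).
(* Induction covers [A] over [G x]. What remains is [k <= m2], shown by packing the [k] multiples
   [o i * y] into [G x] times [I]. *)
rewrite nE leq_mul //; first exact: (IH _ n1lt _ _ _ mA (mG x) (GA x Ax) hn1 hm1).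
have [r2 [_ cov2 _]] := hm2.
rewrite -(card_ord k) -(card_ord m2).
apply: (@leq_packing_cover _ _ _ (ideal_mul (G x) I) (ideal_mul B I)
  (fun i => o i * y) r2) => // [i|i j].
  by apply: mGI.2 => //; case: (oP i).
rewrite -mulrBl; set s := o i - o j => BIsy; apply: inj.
have Os : O s by apply: ring_intB; [case: (oP i) | case: (oP j)].
suff Bsx : B (s * x).
  have [_ [z Bz ->]] := oP i; have [_ [z' Bz' ->]] := oP j.
  have -> : o i * x + z - (o j * x + z') = s * x + (z - z') by rewrite /s; ring.
  by apply: (subgroupD mB.1) => //; exact: (subgroupB mB.1).
(* If [s x] is outside [B], minimality of [k] gives [G (s * x) = G x], so [x] is [c s x] modulo [B].
   Then [1 - c s] kills [G x] modulo [B], hence [y] modulo [B I]; as [s y] lies in [B I], so does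
   [y], a contradiction. *)
apply: contrapT => nBsx.
have Asx : A (s * x) by exact: mA.2.
have Gsub : G (s * x) `<=` G x.
  move=> _ [c [z [Oc Bz ->]]]; exists (c * s), z; split=> //; first exact: ring_intM.
  by rewrite mulrA.
have [k' hk'] := Gidx _ Asx.
have kk' : (k <= k')%N by apply: kmin; apply/asboolP; exists (s * x); split.
have [q1 [q2 [hq1 hq2 kE]]] := has_index_tower (mG (s * x)).1 mB.1 (mG x).1
  (BG (s * x)) Gsub hk.
have q21 : q2 = k' by exact: (has_index_uniq mB.1 hq2 hk').
have q11 : q1 = 1%N.
  have k'0 := has_index_gt0 (mG _).1 hk'; have q10 := has_index_gt0 (mG x).1 hq1.
  by apply/eqP; rewrite eqn_leq q10 andbT -(leq_pmul2r k'0) mul1n -{1}q21 -kE.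
rewrite q11 in hq1.
have [c [z [Oc Bz xE]]] := has_index1_sub (mG x).1 (mG _).1 hq1 (Gx x).
have B1 : B ((1 - c * s) * x).
  have -> : (1 - c * s) * x = x - c * (s * x) by ring.
  by rewrite {1}xE addrC addKr.
have BI1 : ideal_mul B I ((1 - c * s) * y).
  apply: (GIy [set w | ideal_mul B I ((1 - c * s) * w)]).
    split=> [|u v hu hv] /=; first by rewrite mulr0; exact: (subgroup0 sBI).
    by rewrite mulrBr; exact: (subgroupB sBI).
  move=> _ v [c' [z' [Oc' Bz' ->]]] Iv /=; rewrite mulrA; apply: ideal_mul_mem => //.
  have -> : (1 - c * s) * (c' * x + z') = c' * ((1 - c * s) * x) + (1 - c * s) * z' by ring.
  apply: (subgroupD mB.1); apply: mB.2 => //.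
  by apply: ring_intB; [exact: ring_int1 | exact: ring_intM].
apply: nBIy; have -> : y = (1 - c * s) * y + c * (s * y) by ring.
by apply: (subgroupD sBI) => //; apply: mBI.2.
Qed.

End IndexMul.
End Ideals.

(** * Quaternions *)

Section Quaternion.
Variables (F : fieldType) (a b : F).
Implicit Types x y z : quat a b.

Lemma nrdM x y : nrd (x * y) = nrd x * nrd y.
Proof. by rewrite /nrd /=; ring. Qed.

Lemma nrdX x n : nrd (x ^+ n) = nrd x ^+ n.
Proof.
elim: n => [|n IH]; last by rewrite !exprS nrdM IH.
by rewrite !expr0 /nrd /=; ring.
Qed.

Lemma nrdZ c x : nrd (c *: x) = c ^+ 2 * nrd x.
Proof. by rewrite /nrd /=; ring. Qed.

HB.instance Definition _ :=
  GRing.isZmodMorphism.Build (quat a b) F (@qre F a b) (fun _ _ => erefl).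

(** This is [trd (x * conjq y)]; in terms of [nrd], its integrality on an order follows from that of
    [nrd]. *)
Definition nrd_polar x y : F := nrd (x + y) - nrd x - nrd y.

Lemma nrdD x c y : nrd (x + c *: y) = nrd x + c ^+ 2 * nrd y + c * nrd_polar x y.
Proof. by rewrite /nrd_polar /nrd /=; ring. Qed.

Lemma nrd_polarD x c y z :
  nrd_polar (x + c *: y) z = nrd_polar x z + c * nrd_polar y z.
Proof. by rewrite /nrd_polar /nrd /=; ring. Qed.

Lemma nrd1D y : nrd (1 + y) = 1 + trd y + nrd y.
Proof. by rewrite /nrd /trd /=; ring. Qed.

Lemma nrd_eq0 x : division_algebra (quat a b) -> nrd x = 0 -> x = 0.
Proof.
move=> D_div x0; apply/eqP; apply: contraT => /D_div[y [xy _]].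
have := congr1 (@nrd F a b) xy; rewrite nrdM x0 mul0r /nrd /= => /eqP.
by rewrite !(expr0n, expr1n, mulr0, subr0, addr0) /= eq_sym oner_eq0.
Qed.

(** For [nrd x = 1] one has [nrd (x - 1) = 2 - trd x], and in a division algebra only 0 has reduced
    norm 0. *)
Lemma norm1_trd_neq2 x : division_algebra (quat a b) -> nrd x = 1 -> x <> 1 ->
  trd x - 2 != 0.
Proof.
move=> D_div nx x1; apply/eqP => t0; apply: x1; apply/subr0_eq.
apply: nrd_eq0 => //; move: nx; rewrite -{1}[x](subrKC 1) nrd1D.
have -> : trd (x - 1) = trd x - 2 by rewrite /trd /=; ring.
by rewrite t0 addr0 => /(canRL (addKr _)); rewrite addNr.
Qed.

End Quaternion.

(** * Integrality of norms and traces on the order *)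

Section Order.
Variables (K : fieldExtType rat) (a b kappa : K) (Q : set (quat a b)) (I : set K).
Local Notation O := (@ring_int K).
Hypotheses (a_int : O a) (b_int : O b) (Q_order : is_order Q).
Hypotheses (O_sub_Q : forall c : K, O c -> Q c%:A).
Hypotheses (kappa_int : O kappa) (kappa_neq0 : kappa != 0).
Hypothesis Q_sub : Q `<=` [set kappa^-1 *: y | y in @standard_order K a b].

Lemma ring_int_finitely_generated : exists n (e : 'I_n -> K),
  forall x, O x -> exists c : 'I_n -> int, x = \sum_i (c i)%:~R * e i.
Proof.
case: Q_order => _ _ _ [n [e QE]] _; exists n, (fun i => qre (e i)) => x /O_sub_Q.
rewrite QE => -[c _ /(congr1 (@qre K a b))]; rewrite raddf_sum /= mulr1 => <-.
exists c; apply: eq_bigr => i _; rewrite mulrzl.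
exact: raddfMz.
Qed.

Lemma order_scale q : Q q -> @standard_order K a b (kappa *: q).
Proof. by move=> /Q_sub[y Oy <-]; rewrite scalerA divff // scale1r. Qed.

Lemma nrd_standard_order (y : quat a b) : standard_order y -> O (nrd y).
Proof.
case=> O0 O1 O2 O3; rewrite /nrd; have sO := @ring_int_subgroup K.
apply: (subgroupD sO).
  apply: ring_intB; [apply: ring_intB|].
  - exact: ring_intX.
  - by apply: ring_intM => //; exact: ring_intX.
  - by apply: ring_intM => //; exact: ring_intX.
by apply: ring_intM; [exact: ring_intM | exact: ring_intX].
Qed.

Hypothesis finite_index : forall t : K, O t -> t != 0 ->
  exists n, has_index O (dilate t O) n.

(* The denominators of the powers of [nrd q] are bounded by [kappa ^+ 2]. *)
Lemma nrd_order q : Q q -> O (nrd q).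
Proof.
move=> Qq; case: (Q_order) => Q1 _ QM _ _.
apply: (almost_integral finite_index (t := kappa ^+ 2)); first exact: ring_intX.
  exact: expf_neq0.
move=> n; rewrite -nrdX -nrdZ; apply/nrd_standard_order/order_scale.
by elim: n => [|n IH]; rewrite ?expr0 ?exprS //; exact: QM.
Qed.

Lemma nrd_polar_order p q : Q p -> Q q -> O (nrd_polar p q).
Proof.
move=> Qp Qq; case: (Q_order) => Q1 QB _ _ _.
have Q0 : Q 0 by rewrite -(subrr 1); exact: QB.
have QN : Q (- q) by rewrite -sub0r; exact: QB.
do 2?apply: ring_intB; apply: nrd_order => //.
by rewrite -[q]opprK; exact: QB.
Qed.

Hypothesis I_ideal : ideal_ring_int I.

Lemma ideal_ring_int_submodule : submodule I.
Proof.
case: I_ideal => _ I0 ID IM; split=> //; split=> // x y Ix Iy.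
by apply: ID => //; rewrite -mulN1r; apply: IM => //; exact: (ring_int_intr K (-1)).
Qed.

Lemma nrd_ideal_order y : ideal_order I Q y -> ideal_mul I I (nrd y).
Proof.
case=> n [c [q [Ic Qq ->]]].
have II := ideal_mul_subgroup I I.
have [_ IIM] := ideal_mul_submodule I ideal_ring_int_submodule.
(* The second clause supplies the cross terms when a summand is added; [d] stands for the
   coefficient of that summand. *)
suff [] : ideal_mul I I (nrd (\sum_i c i *: q i)) /\ forall p d, Q p -> I d ->
    ideal_mul I I (d * nrd_polar (\sum_i c i *: q i) p) by [].
elim/big_rec: _ => [|i y' _ [IH1 IH2]].
  have -> : nrd (0 : quat a b) = 0 by rewrite /nrd /=; ring.
  split=> [|p d _ _]; first exact: (subgroup0 II).
  have -> : nrd_polar 0 p = 0 by rewrite /nrd_polar /nrd /=; ring.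
  by rewrite mulr0; exact: (subgroup0 II).
rewrite addrC; split=> [|p d Qp Id].
  rewrite nrdD; apply: (subgroupD II); last exact: IH2.
  apply: (subgroupD II) => //; rewrite mulrC; apply: IIM; first exact: nrd_order.
  by rewrite expr2; exact: ideal_mul_mem.
rewrite nrd_polarD mulrDr mulrA; apply: (subgroupD II); first exact: IH2.
rewrite mulrC; apply: IIM; first exact: nrd_polar_order.
exact: ideal_mul_mem.
Qed.

Lemma qre_ideal_order y : ideal_order I Q y -> I (kappa * qre y).
Proof.
case=> n [c [q [Ic Qq ->]]]; have [sI IM] := ideal_ring_int_submodule.
rewrite raddf_sum mulr_sumr; apply: (subgroup_sum sI) => i _.
by rewrite /= mulrCA mulrC; apply: IM => //; case: (order_scale (Qq i)).
Qed.

Lemma congruence_subgroup_trd x : congruence_subgroup Q I x ->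
  ideal_mul I I (trd x - 2) /\ exists2 v, I v & kappa * (trd x - 2) = 2 * v.
Proof.
move=> [[_ nx] Iy]; have tE : trd x - 2 = trd (x - 1) by rewrite /trd /=; ring.
split; last first.
  exists (kappa * qre (x - 1)); first exact: qre_ideal_order.
  by rewrite tE /trd mulrCA.
have -> : trd x - 2 = - nrd (x - 1).
  move: nx; rewrite -{1}[x](subrKC 1) nrd1D tE -addrA => /(canRL (addKr _)).
  by rewrite addNr => /eqP; rewrite addr_eq0 => /eqP.
apply: subgroupN (ideal_mul_subgroup I I) _ _.
exact: nrd_ideal_order.
Qed.

End Order.

(** * Norm bounds *)

Section NormInequality.
Variables (K : fieldExtType rat) (d : nat) (I : set K) (kappa : K).
Local Notation O := (@ring_int K).
Local Notation J := (two_plus_ideal kappa I).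
Hypothesis finite_index : forall t : K, O t -> t != 0 ->
  exists n, has_index O (dilate t O) n.
Hypothesis index2 : has_index O (dilate 2 O) (2 ^ d).
Hypotheses (mI : submodule I) (IO : I `<=` O) (I_neq0 : exists2 y, I y & y != 0).
Hypothesis kappa_int : O kappa.

Let sO := @ring_int_subgroup K.
Let O2 : O 2. Proof. exact: ring_int_intr 2. Qed.
Let two_neq0 : 2 != 0 :> K. Proof. exact: (@intr_neq0 K 2). Qed.

Lemma two_plus_ideal_submodule : submodule J.
Proof.
have [[I0 IB] IM] := mI; split; first split.
- by exists 0; [exact: ring_int0 | exists 0; rewrite // !mulr0 addr0].
- move=> _ _ [x Ox [y Iy <-]] [x' Ox' [y' Iy' <-]].
  exists (x - x'); first exact: ring_intB.
  by exists (y - y'); [exact: IB | ring].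
- move=> c _ Oc [x Ox [y Iy <-]]; exists (c * x); first exact: ring_intM.
  by exists (c * y); [exact: IM | ring].
Qed.

Lemma two_plus_ideal_sub : J `<=` O.
Proof.
move=> _ [x Ox [y Iy <-]]; apply: (subgroupD sO); first exact: ring_intM.
by apply: ring_intM => //; exact: IO.
Qed.

Lemma two_plus_ideal2 : J 2.
Proof.
by exists 1; [exact: ring_int1 | exists 0; [exact: (subgroup0 mI.1) | ring]].
Qed.

Lemma has_index_two_plus_ideal : has_index O J (ideal_norm J).
Proof.
have mJ := two_plus_ideal_submodule.
have [n h] := ideal_has_index finite_index mJ two_plus_ideal_sub O2 two_neq0 two_plus_ideal2.
by rewrite (has_index_ideal_norm mJ.1 h).
Qed.

(** [J] contains [2 O], of index [2 ^ d]. This turns the first estimate of each case into the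
    second. *)
Lemma two_plus_ideal_norm_le : (ideal_norm J <= 2 ^ d)%N.
Proof.
have mJ := two_plus_ideal_submodule.
have [] := has_index_tower mJ.1 (subgroup_dilate 2 sO) sO _ two_plus_ideal_sub index2.
  by move=> _ [x Ox <-]; rewrite mulrC; apply: mJ.2 => //; exact: two_plus_ideal2.
move=> m [k [hm hk ->]].
rewrite (has_index_uniq mJ.1 has_index_two_plus_ideal hm) leq_pmulr //.
exact: (has_index_gt0 mJ.1 hk).
Qed.

Lemma two_plus_ideal_norm_gt0 : (0 < ideal_norm J)%N.
Proof. exact: (has_index_gt0 sO has_index_two_plus_ideal). Qed.

Lemma has_index_ideal : has_index O I (ideal_norm I).
Proof.
have [y Iy y0] := I_neq0.
have [n h] := ideal_has_index finite_index mI IO (IO Iy) y0 Iy.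
by rewrite (has_index_ideal_norm mI.1 h).
Qed.

Lemma ideal_norm_gt0 : (0 < ideal_norm I)%N.
Proof. exact: (has_index_gt0 sO has_index_ideal). Qed.

(** The index of [I ^ 2] is that of [I] in [O] times that of [I I] in [O I]; since [I] is
    invertible, the second factor is at least the first. *)
Lemma norm_square_ideal_le : exists2 n, has_index O (ideal_mul I I) n &
  (ideal_norm I ^ 2 <= n)%N.
Proof.
have [y Iy y0] := I_neq0; have mII := ideal_mul_submodule I mI.
have III : ideal_mul I I `<=` I by exact: ideal_mul_sub.
have IIO : ideal_mul I I `<=` O by move=> x /III/IO.
have [n h] := ideal_has_index finite_index mII IIO (ring_intM (IO Iy) (IO Iy))
  (mulf_neq0 y0 y0) (ideal_mul_mem Iy Iy).
exists n => //.
have [m [k [hm hk ->]]] := has_index_tower mI.1 mII.1 sO III IO h.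
rewrite (has_index_uniq mI.1 hm has_index_ideal) -mulnn leq_mul2l orbC.
have inv := ideal_mul_inv finite_index mI IO Iy y0.
suff -> : (ideal_norm I <= k)%N by [].
apply: (has_index_mul_ideal inv (ring_int_submodule K) mI IO has_index_ideal).
by rewrite ideal_mul1.
Qed.

(* [t J] is contained in [2 I ^ 2], where [J = <2> + kappa I]. *)
Lemma trace_norm_bound (t : K) (n : nat) : t != 0 -> ideal_mul I I t ->
  (exists2 v, I v & kappa * t = 2 * v) -> has_index O (dilate t O) n ->
  (2 ^ d * ideal_norm I ^ 2 <= n * ideal_norm J)%N.
Proof.
move=> t0 IIt [v Iv tv] hn; have mII := ideal_mul_submodule I mI.
have mJ := two_plus_ideal_submodule.
have [k hk le_k] := norm_square_ideal_le.
have IIO : ideal_mul I I `<=` O by move=> x /(ideal_mul_sub mI IO)/IO.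
have tO : dilate t O `<=` O.
  by move=> _ [x Ox <-]; apply: ring_intM => //; exact: IIO.
have h2O : dilate 2 O `<=` O by move=> _ [x Ox <-]; exact: ring_intM.
have s2 := subgroup_dilate 2 sO; have st := subgroup_dilate t sO.
have s2I := subgroup_dilate 2 mII.1; have stJ := subgroup_dilate t mJ.1.
have h2I : has_index O (dilate 2 (ideal_mul I I)) (2 ^ d * k).
  apply: has_index_mul index2 _ => //; first exact: dilateS.
  exact: has_index_dilate.
have htJ : has_index O (dilate t J) (n * ideal_norm J).
  apply: has_index_mul hn _ => //; first by apply: dilateS; exact: two_plus_ideal_sub.
  by apply: has_index_dilate => //; exact: has_index_two_plus_ideal.
have sub : dilate t J `<=` dilate 2 (ideal_mul I I).
  move=> _ [_ [x Ox [y Iy <-]] <-]; exists (x * t + v * y).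
    apply: (subgroupD mII.1); first exact: mII.2.
    exact: ideal_mul_mem.
  have -> : t * (2 * x + kappa * y) = 2 * (x * t) + (kappa * t) * y by ring.
  by rewrite tv; ring.
have sub' : dilate 2 (ideal_mul I I) `<=` O by move=> _ [x /IIO Ox <-]; exact: ring_intM.
have [m [k' [hm hk' ->]]] := has_index_tower s2I stJ sO sub sub' htJ.
rewrite (has_index_uniq s2I hm h2I) -mulnA leq_mul2l (leq_trans le_k) ?orbT //.
by rewrite leq_pmulr // (has_index_gt0 s2I hk').
Qed.

End NormInequality.

(** * Real places where the algebra is definite *)

Section RealPlace.
Variables (R : realType) (a b : R).
Hypothesis D_div : division_algebra (quat a b).

(** A nonnegative real [a] is a square [c ^+ 2], and then [i - c] and [i + c] are zero divisors;
    likewise for [b] and [j]. *)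
Lemma division_quat_lt0 : a < 0 /\ b < 0.
Proof.
have no_zero_div (x y : quat a b) : x * y = 0 -> y = 0 \/ x = 0.
  move=> xy; have [->|/D_div[z [_ zx]]] := eqVneq x 0; first by right.
  by left; rewrite -[y]mul1r -zx -mulrA xy mulr0.
have noa (c : R) : c ^+ 2 != a.
  apply/eqP => ca.
  have [||] := no_zero_div (Quat a b (- c) 1 0 0) (Quat a b c 1 0 0).
  - apply: quat_eq; rewrite /= !(mulr0, mul0r, mulr1, mul1r, subr0, addr0) //.
      by rewrite -ca; ring.
    by rewrite addrC subrr.
  - by move=> /(congr1 (@qi R a b))/eqP; rewrite oner_eq0.
  - by move=> /(congr1 (@qi R a b))/eqP; rewrite oner_eq0.
have nob (c : R) : c ^+ 2 != b.
  apply/eqP => cb.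
  have [||] := no_zero_div (Quat a b (- c) 0 1 0) (Quat a b c 0 1 0).
  - apply: quat_eq; rewrite /= !(mulr0, mul0r, mulr1, mul1r, subr0, addr0, oppr0) //.
      by rewrite -cb; ring.
    by rewrite addrC subrr.
  - by move=> /(congr1 (@qj R a b))/eqP; rewrite oner_eq0.
  - by move=> /(congr1 (@qj R a b))/eqP; rewrite oner_eq0.
by split; rewrite ltNge; apply/negP => /sqr_sqrtr/eqP; apply/negP.
Qed.

(** With [a] and [b] negative, [nrd] is a sum of four nonnegative terms, so [x0] lies in [[-1, 1]]
    and [2 x0 - 2] in [[-4, 0]]. The value -4 forces the other coordinates to vanish, that is
    [x = -1]. *)
Lemma definite_norm1_trd (x : quat a b) : nrd x = 1 -> x <> -1 ->
  `|trd x - 2| < 4.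
Proof.
have [a0 b0] := division_quat_lt0.
case: x => x0 x1 x2 x3; rewrite /nrd /trd /= => nx xN1.
have x1a : a * x1 ^+ 2 <= 0 by rewrite mulr_le0_ge0 ?sqr_ge0 // ltW.
have x2b : b * x2 ^+ 2 <= 0 by rewrite mulr_le0_ge0 ?sqr_ge0 // ltW.
have ab : 0 < a * b by rewrite nmulr_rgt0.
have x3ab : 0 <= a * b * x3 ^+ 2 by rewrite mulr_ge0 ?sqr_ge0 // ltW.
have definite (p u v w : R) : p - u - v + w = 1 -> u <= 0 -> v <= 0 -> 0 <= w ->
    p <= 1 /\ (p = 1 -> [/\ u = 0, v = 0 & w = 0]).
  by move=> *; split=> [|*]; [|split]; lra.
have [x0le x0eq] := definite _ _ _ _ nx x1a x2b x3ab.
have x0N1 : x0 != -1.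
  apply/eqP => e; apply: xN1.
  have [|/eqP + /eqP + /eqP] := x0eq; first by rewrite e sqrrN expr1n.
  rewrite !mulf_eq0 !(lt_eqF a0) !(lt_eqF b0) /= !orbb.
  by move=> /eqP-> /eqP-> /eqP->; apply: quat_eq; rewrite /= ?oppr0.
have /andP[lo hi] : -1 <= x0 <= 1 by rewrite -ler_norml -(@expr_le1 _ 2) // real_normK ?num_real.
have lo' : -1 < x0 by rewrite lt_neqAle eq_sym x0N1.
clear -lo' hi; by rewrite ltr_norml; apply/andP; split; lra.
Qed.

End RealPlace.

(** Only the empty product attains the bound; the degree conditions in the theorem come from
    here. *)
Lemma prod_lteif (R : realDomainType) (J : finType) (P : pred J) (f : J -> R) (c : R) :
  (forall i, P i -> 0 <= f i < c) -> \prod_(i | P i) f i < c ^+ #|P| ?<= if (#|P| == 0%N).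
Proof.
move=> fc; have [P0|P0] := posnP #|P|.
  by rewrite lteifT P0 expr0 big_pred0 // => i; exact: (card0_eq P0 i).
rewrite lteifF -prodr_const; apply: ltr_prod => //.
have /card_gt0P[i Pi] := P0.
by apply/hasP; exists i; rewrite ?mem_index_enum.
Qed.

Section RealEmbeddings.
Variables (R : realType) (K : fieldExtType rat).

Lemma real_embedding_Re (s : {rmorphism K -> R[i]}) : real_embedding s ->
  exists s' : {rmorphism K -> R}, forall x, s x = (s' x)%:C%C.
Proof.
move=> s_real; pose f x := complex.Re (s x).
have sE x : s x = (f x)%:C%C.
  by rewrite /f; have := s_real x; case: (s x) => u v /= ->.
have fB : zmod_morphism f.
  by move=> x y; apply: complexI; rewrite rmorphB /= -!sE rmorphB.
have fM : monoid_morphism f.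
  split=> [|x y]; apply: complexI; first by rewrite -sE !rmorph1.
  by rewrite rmorphM /= -!sE rmorphM.
pose f' : {rmorphism K -> R} := HB.pack f
  (GRing.isZmodMorphism.Build _ _ f fB) (GRing.isMonoidMorphism.Build _ _ f fM).
by exists f'.
Qed.

Lemma absC_real (x : R) : absC x%:C%C = `|x|.
Proof. by rewrite /absC /ComplexField.Normc.normc /= expr0n /= addr0 sqrtr_sqr. Qed.

Lemma absC_conj (z : R[i]) : absC (conjc z) = absC z.
Proof. by case: z => u v; rewrite /absC /= sqrrN. Qed.

Lemma normr_absC (z : R[i]) : `|z| = (absC z)%:C%C.
Proof. by rewrite normc_def; case: z. Qed.

Lemma absC_ge0 (z : R[i]) : 0 <= absC z.
Proof. by case: z => u v; exact: sqrtr_ge0. Qed.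

Lemma absC_subr_nat (z : R[i]) n : absC (z - n%:R) <= absC z + n%:R.
Proof.
rewrite -lecR rmorphD /= -!normr_absC.
by rewrite (le_trans (ler_normB _ _)) // normr_nat rmorph_nat.
Qed.

Lemma real_embedding_trd_lt4 (a b : K) (s : {rmorphism K -> R[i]}) (x : quat a b) :
  real_embedding s ->
  (forall s' : {rmorphism K -> R}, (forall x, s x = (s' x)%:C%C) ->
    division_algebra (quat (s' a) (s' b))) ->
  nrd x = 1 -> x <> -1 -> absC (s (trd x - 2)) < 4.
Proof.
move=> /real_embedding_Re[s' sE] D_div nx xN1.
pose y := base_change s' x.
have ny : nrd y = 1.
  by rewrite -(rmorph1 s') -nx /nrd /= !(rmorphD, rmorphB, rmorphN, rmorphM, rmorphXn).
have yN1 : y <> -1.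
  move=> e; apply: xN1.
  have [e0 e1 e2 e3] : [/\ s' (qre x) = s' (-1), s' (qi x) = s' 0,
      s' (qj x) = s' 0 & s' (qk x) = s' 0].
    have [[[h0 h1] h2] h3] := (congr1 (@qre _ _ _) e, congr1 (@qi _ _ _) e,
      congr1 (@qj _ _ _) e, congr1 (@qk _ _ _) e).
    by rewrite rmorphN1 rmorph0; move: h0 h1 h2 h3; rewrite /= !oppr0.
  by apply: quat_eq; rewrite /= ?oppr0; apply: (fmorph_inj s').
have := definite_norm1_trd (D_div _ sE) ny yN1.
by rewrite sE absC_real /trd /= rmorphB rmorphM rmorph_nat.
Qed.

End RealEmbeddings.

(** * The inequality for the product over all embeddings *)

Section Bound.
Variables (R : realType) (K : fieldExtType rat) (a b kappa : K)
  (Q : set (quat a b)) (I : set K).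
Hypotheses (a_int : ring_int a) (b_int : ring_int b)
  (D_div : division_algebra (quat a b)) (Q_order : is_order Q)
  (O_sub_Q : forall c : K, ring_int c -> Q c%:A)
  (kappa_int : ring_int kappa) (kappa_neq0 : kappa != 0)
  (Q_sub : Q `<=` [set kappa^-1 *: y | y in @standard_order K a b])
  (I_ideal : ideal_ring_int I) (I_neq0 : exists2 y, I y & y != 0).
Local Notation d := (\dim {:K}).
Local Notation NI := (ideal_norm I).
Local Notation N2 := (ideal_norm (two_plus_ideal kappa I)).

(** Common to both cases. As [s] lists every embedding exactly once, the given place, and its
    conjugate if it is complex, can be split off the product. *)
Lemma prod_embeddings_bound : exists s : 'I_d -> {rmorphism K -> R[i]},
  [/\ forall i j, s i =1 s j -> i = j,
      forall sigma : {rmorphism K -> R[i]}, exists i, sigma =1 s i,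
      [/\ (0 < NI)%N, (0 < N2)%N & (N2 <= 2 ^ d)%N]
    & forall x, congruence_subgroup Q I x -> x <> 1 ->
        (forall i, 0 < absC (s i (trd x - 2))) /\
        2 ^+ d * NI%:R ^+ 2 <= (\prod_i absC (s i (trd x - 2))) * N2%:R :> R].
Proof.
have [theta [s [inj surj span free norm]]] := embeddings_power_basis K R[i].
exists s.
have d0 : (0 < d)%N by rewrite adim_gt0.
have O_fg := ring_int_finitely_generated Q_order O_sub_Q.
have idx t : t != 0 -> ring_int t -> exists2 N, has_index (@ring_int K) (dilate t (@ring_int K)) N
    & N%:R = \prod_i `|s i t|.
  exact: (has_index_ring_int span free d0 O_fg norm).
have fin t : ring_int t -> t != 0 -> exists n, has_index (@ring_int K) (dilate t (@ring_int K)) n.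
  by move=> Ot t0; have [N hN _] := idx t t0 Ot; exists N.
have idx2 : has_index (@ring_int K) (dilate 2 (@ring_int K)) (2 ^ d).
  exact: (has_index_ring_int_intr span free d0 O_fg (isT : 2 != 0 :> int)).
have mI := ideal_ring_int_submodule I_ideal.
have IO : I `<=` @ring_int K by case: I_ideal.
split=> //.
  split; first exact: (ideal_norm_gt0 fin mI IO I_neq0).
    exact: (two_plus_ideal_norm_gt0 fin mI IO kappa_int).
  exact: (two_plus_ideal_norm_le fin idx2 mI IO kappa_int).
move=> x xQI x1; have nx : nrd x = 1 by case: xQI => -[].
have t0 := norm1_trd_neq2 D_div nx x1; set t := trd x - 2 in t0 *.
have [IIt tv] := congruence_subgroup_trd a_int b_int Q_order kappa_int kappa_neq0
  Q_sub fin I_ideal xQI.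
have Ot : ring_int t := IO _ (ideal_mul_sub mI IO IIt).
have [N hN NE] := idx t t0 Ot.
have := trace_norm_bound fin idx2 mI IO I_neq0 kappa_int t0 IIt tv hN.
have eE : (2 ^ d * NI ^ 2)%:R = 2 ^+ d * NI%:R ^+ 2 :> R by rewrite natrM !natrX.
rewrite -(ler_nat R) eE natrM => le_N.
have -> : \prod_i absC (s i t) = N%:R.
  apply: complexI; rewrite rmorph_nat NE rmorph_prod.
  by apply: eq_bigr => i _; rewrite normr_absC.
split=> // i; rewrite lt_neqAle absC_ge0 andbT eq_sym.
by rewrite -(inj_eq (@complexI R)) -normr_absC normr_eq0 fmorph_eq0.
Qed.

End Bound.

(** * Solving for the factor at the given place *)

Section Numeric.
Variable R : realType.
Implicit Types (d : nat) (N M X P T : R).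

Lemma exprz2B d (k : nat) : 2 ^ (d%:Z - k%:Z) = 2 ^+ d / 2 ^+ k :> R.
Proof. by rewrite expfzDr ?pnatr_eq0 // exprnN. Qed.

Lemma lteif_le_lt (x y : R) (c : bool) : x <= y -> (~~ c -> x < y) -> x < y ?<= if c.
Proof. by case: c => // _; apply. Qed.

(** [X] is the absolute value of [t] at the given place, [P] the product over the other embeddings,
    [T] the absolute value of the trace, [N] and [M] the norms of [I] and [<2> + kappa I]. *)
Lemma real_place_bound d N M X P T : (0 < d)%N -> 0 <= N -> 0 < M -> M <= 2 ^+ d ->
  0 < X -> X <= T + 2 -> P < 4 ^+ d.-1 ?<= if (d == 1%N) ->
  2 ^+ d * N ^+ 2 <= X * P * M ->
  (2 ^ (d%:Z - 2) * M)^-1 * N ^+ 2 - 2 < T ?<= if (d == 1%N) /\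
  (2 ^ (2 * d%:Z - 2))^-1 * N ^+ 2 - 2 < T ?<= if (d == 1%N).
Proof.
case: d => // m _; set c := (_ == _); move: c => c N0 M0.
rewrite /= [2 ^+ m.+1]exprS => ME X0 XT PF.
have -> : 2 * m.+1%:Z - 2 = (2 * m)%N%:Z by rewrite PoszM; lia.
have e4 : 4 ^+ m = (2 ^+ m) ^+ 2 :> R.
  by rewrite -exprM mulnC exprM; congr (_ ^+ _); ring.
rewrite e4 in PF.
rewrite exprz2B -exprnP [2 ^+ m.+1]exprS mulnC exprM.
have F0 : 0 < 2 ^+ m :> R by rewrite exprn_gt0.
move: (2 ^+ m) F0 ME PF => F F0 ME PF h.
have FM0 : 0 < 2 * F / 2 ^+ 2 * M by rewrite !mulr_gt0 ?invr_gt0 ?exprn_gt0.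
have XM : 0 < X * M by rewrite mulr_gt0.
have hF : 2 * F * N ^+ 2 <= P * (X * M) by rewrite mulrA [P * X]mulrC.
have key (Z : R) : P <= Z -> 2 * F * N ^+ 2 <= Z * (X * M).
  by move=> PZ; rewrite (le_trans hF) // ler_pM2r.
have b1 : (2 * F / 2 ^+ 2 * M)^-1 * N ^+ 2 <= X.
  rewrite ler_pdivrMl // -(ler_pM2l (_ : 0 < 2 * F)) ?mulr_gt0 //.
  rewrite (le_trans (key _ (lteifW PF))) //.
  by rewrite le_eqVlt; apply/orP; left; apply/eqP; field.
have b2 : ~~ c -> (2 * F / 2 ^+ 2 * M)^-1 * N ^+ 2 < X.
  move=> /negbTE cF; rewrite cF lteifF in PF.
  rewrite ltr_pdivrMl // -(ltr_pM2l (_ : 0 < 2 * F)) ?mulr_gt0 //.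
  rewrite (le_lt_trans hF) // (_ : _ * (_ * X) = F ^+ 2 * (X * M)); last by field.
  by rewrite ltr_pM2r.
(* Here [F] is [2 ^ (d - 1)], and [M <= 2 ^ d] is used. *)
have b3 : (F ^+ 2)^-1 * N ^+ 2 <= (2 * F / 2 ^+ 2 * M)^-1 * N ^+ 2.
  rewrite ler_wpM2r ?sqr_ge0 // lef_pV2 ?posrE ?exprn_gt0 //.
  rewrite (_ : F ^+ 2 = 2 * F / 2 ^+ 2 * (2 * F)); last by field.
  by rewrite ler_pM2l // !mulr_gt0 ?invr_gt0 ?exprn_gt0.
split; apply: lteif_le_lt => [|/b2 b].
- by rewrite lerBlDr (le_trans b1).
- by rewrite ltrBlDr (lt_le_trans b).
- by rewrite lerBlDr (le_trans b3) // (le_trans b1).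
- by rewrite ltrBlDr (le_lt_trans b3) // (lt_le_trans b).
Qed.

(** The given place enters as [X ^+ 2]; the bound is the square root of
    [2 ^ d * N ^ 2 / (4 ^ (d - 2) * M)]. *)
Lemma complex_place_bound d N M X P T : (1 < d)%N -> 0 <= N -> 0 < M -> M <= 2 ^+ d ->
  0 < X -> X <= T + 2 -> P < 4 ^+ d.-2 ?<= if (d == 2%N) ->
  2 ^+ d * N ^+ 2 <= X ^+ 2 * P * M ->
  (2 `^ (d%:R / 2 - 2) * M `^ (2^-1))^-1 * N - 2 < T ?<= if (d == 2%N) /\
  (2 ^ (d%:Z - 2))^-1 * `|N| - 2
    <= (2 `^ (d%:R / 2 - 2) * M `^ (2^-1))^-1 * N - 2.
Proof.
case: d => [|[|m]] // _; set c := (_ == _); move: c => c N0 M0 ME X0 XT PF h.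
have e0 : 0 < 2 `^ (m.+2%:R / 2) :> R by rewrite powR_gt0.
have n0 : 0 < M `^ (2^-1) by rewrite powR_gt0.
have eE : (2 `^ (m.+2%:R / 2)) ^+ 2 = 2 ^+ m.+2 :> R.
  by rewrite -powR_mulrn ?powR_ge0 // -powRrM divfK ?pnatr_eq0 // powR_mulrn.
have nE : (M `^ (2^-1)) ^+ 2 = M by rewrite powR12_sqrt ?ltW // sqr_sqrtr ?ltW.
have -> : 2 `^ (m.+2%:R / 2 - 2) = 2 `^ (m.+2%:R / 2) / 4 :> R.
  rewrite powRB ?pnatr_eq0 ?implybT //; congr (_ / _).
  by rewrite powR_mulrn // -natrX.
(* [e] is [2 ^ (d / 2)] and [n] the square root of [M], from now on known only by their signs and
   squares. *)
rewrite exprz2B; move: (2 `^ _) (M `^ _) e0 n0 eE nE => e n e0 n0 eE nE.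
rewrite -eE; rewrite -nE -eE in ME h.
have [e0' n0'] := (ltW e0, ltW n0).
have ne : n <= e by rewrite -ler_sqr ?nnegrE.
have F4 : 4 ^+ m = (e ^+ 2 / 4) ^+ 2 :> R.
  have -> : e ^+ 2 / 4 = 2 ^+ m by rewrite eE !exprS; field.
  by rewrite -exprM mulnC exprM; congr (_ ^+ _); ring.
rewrite /= F4 in PF.
have XM : 0 < X ^+ 2 * n ^+ 2 by rewrite mulr_gt0 ?exprn_gt0.
have hF : e ^+ 2 * N ^+ 2 <= P * (X ^+ 2 * n ^+ 2) by rewrite mulrA [P * _]mulrC.
have en0 : 0 < e / 4 * n by rewrite !mulr_gt0 ?invr_gt0.
have enX0 : 0 <= e / 4 * n * X by rewrite ltW // mulr_gt0.
have sq : (e ^+ 2 / 4) ^+ 2 * (X ^+ 2 * n ^+ 2) = e ^+ 2 * (e / 4 * n * X) ^+ 2.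
  by field.
have b1 : (e / 4 * n)^-1 * N <= X.
  rewrite ler_pdivrMl // -ler_sqr ?nnegrE //.
  rewrite -(ler_pM2l (_ : 0 < e ^+ 2)) ?exprn_gt0 // -sq (le_trans hF) //.
  by rewrite ler_pM2r // (lteifW PF).
have b2 : ~~ c -> (e / 4 * n)^-1 * N < X.
  move=> /negbTE cF; rewrite cF lteifF in PF.
  rewrite ltr_pdivrMl // -ltr_sqr ?nnegrE //.
  rewrite -(ltr_pM2l (_ : 0 < e ^+ 2)) ?exprn_gt0 // -sq (le_lt_trans hF) //.
  by rewrite ltr_pM2r.
split; first apply: lteif_le_lt => [|/b2 b].
- by rewrite lerBlDr (le_trans b1).
- by rewrite ltrBlDr (lt_le_trans b).
rewrite lerD2r ger0_norm // ler_wpM2r // lef_pV2 ?posrE ?mulr_gt0 ?invr_gt0 ?exprn_gt0 //.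
rewrite (_ : e ^+ 2 / 2 ^+ 2 = e / 4 * e); last by field.
by rewrite ler_pM2l // mulr_gt0 ?invr_gt0.
Qed.

End Numeric.

(* [x < y ?<= if C] is [x <= y] if [C] holds and [x < y] otherwise.  Strictness
   comes from the archimedean places other than the given one; there are none
   when d = 1 over the reals, resp. d = 2 over the complex numbers, and
   equality can then occur. *)
Theorem theorem2p3 (R : realType) (K : fieldExtType rat) (a b kappa : K)
    (Q : set (quat a b)) (I : set K)
    (a_int : ring_int a) (b_int : ring_int b)
    (D_div : division_algebra (quat a b))
    (Q_order : is_order Q)
    (O_sub_Q : forall c : K, ring_int c -> Q c%:A)
    (kappa_int : ring_int kappa) (kappa_neq0 : kappa != 0)
    (Q_sub : Q `<=` [set kappa^-1 *: y | y in @standard_order K a b])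
    (I_ideal : ideal_ring_int I) (I_neq0 : exists2 y, I y & y != 0) :
  let d := \dim {:K} in
  let NI : R := (ideal_norm I)%:R in
  let N2 : R := (ideal_norm (two_plus_ideal kappa I))%:R in
  (forall iota : {rmorphism K -> R},
     totally_real R K ->
     split_algebra (quat (iota a) (iota b)) ->
     (forall s : {rmorphism K -> R}, ~ (s =1 iota) ->
        division_algebra (quat (s a) (s b))) ->
     forall x, congruence_subgroup Q I x -> x <> 1 -> x <> -1 ->
       (2 ^ (d%:Z - 2) * N2)^-1 * NI ^+ 2 - 2 < `|iota (trd x)|
         ?<= if (d == 1%N)
       /\ (2 ^ (2 * d%:Z - 2))^-1 * NI ^+ 2 - 2 < `|iota (trd x)|
         ?<= if (d == 1%N))
  /\
  (forall iota : {rmorphism K -> R[i]},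
     only_complex_place iota ->
     split_algebra (quat (iota a) (iota b)) ->
     (forall s : {rmorphism K -> R}, division_algebra (quat (s a) (s b))) ->
     forall x, congruence_subgroup Q I x -> x <> 1 -> x <> -1 ->
       (2 `^ (d%:R / 2 - 2) * N2 `^ (2^-1))^-1 * NI - 2 < absC (iota (trd x))
         ?<= if (d == 2%N)
       /\ (2 ^ (d%:Z - 2))^-1 * `|NI| - 2
          <= (2 `^ (d%:R / 2 - 2) * N2 `^ (2^-1))^-1 * NI - 2).
Proof.
move=> d NI N2.
have [s [inj surj [NI0 N20 N2le] bound]] := prod_embeddings_bound R a_int b_int D_div
  Q_order O_sub_Q kappa_int kappa_neq0 Q_sub I_ideal I_neq0.
have d0 : (0 < d)%N by exact: adim_gt0.
have N0 : 0 <= NI by exact: ler0n.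
have M0 : 0 < N2 by rewrite ltr0n.
have ME : N2 <= 2 ^+ d by rewrite -natrX ler_nat.
split=> iota.
- move=> real_s _ div_s x xQI x1 xN1.
  have nx : nrd x = 1 by case: xQI => -[].
  have [t0 h] := bound x xQI x1.
  pose sigma : {rmorphism K -> R[i]} := real_complex R \o iota.
  have [k sk] := surj sigma.
  have kE y : absC (s k y) = `|iota y| by rewrite -sk; exact: absC_real.
  apply: (@real_place_bound _ d NI N2 `|iota (trd x - 2)|
    (\prod_(i | i != k) absC (s i (trd x - 2)))) => //.
  + by rewrite -kE.
  + rewrite rmorphB rmorph_nat (le_trans (ler_normB _ _)) // normr_nat //.
  + have -> : d.-1 = #|[pred i | i != k]| by rewrite cardC1 card_ord.
    have -> : (d == 1%N) = (#|[pred i | i != k]| == 0%N).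
      by rewrite cardC1 card_ord -{1}(prednK d0).
    apply: prod_lteif => i ik; rewrite absC_ge0 /=.
    apply: real_embedding_trd_lt4 nx xN1 => [|s' s'E]; first exact: real_s.
    (* If the real form of [s i] were [iota], then [i] would be [k]. *)
    apply: div_s => e; move/negP: ik; apply; apply/eqP/inj => y.
    by rewrite s'E e -sk.
  + by rewrite -kE; move: h; rewrite (bigD1 k).
- move=> [iota_nreal cplx] _ div_s x xQI x1 xN1.
  have nx : nrd x = 1 by case: xQI => -[].
  have [t0 h] := bound x xQI x1.
  have [k sk] := surj iota.
  pose sigma : {rmorphism K -> R[i]} := conjc \o iota.
  have [l sl] := surj sigma.
  (* Equal indices would make [iota] its own conjugate, hence real. *)
  have lk : l != k.
    apply/eqP => lk; apply: iota_nreal => y.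
    have := sl y; rewrite lk -sk /=; case: (iota y) => u v /= [] e.
    by apply/eqP; rewrite /= -eqNr e.
  have card_d : d = (#|[pred i | (i != k) && (i != l)]|).+2.
    have := cardC1 k; rewrite card_ord => e.
    have := cardD1 l [pred i | i != k]; rewrite e inE lk add1n => e'.
    rewrite -(prednK d0) e'; congr _.+2; apply: eq_card => i.
    by rewrite !inE andbC.
  apply: (@complex_place_bound _ d NI N2 (absC (iota (trd x - 2)))
    (\prod_(i | (i != k) && (i != l)) absC (s i (trd x - 2)))) => //.
  + by rewrite card_d.
  + by rewrite sk.
  + by rewrite rmorphB rmorph_nat absC_subr_nat.
  + have -> : (d == 2%N) = (#|[pred i | (i != k) && (i != l)]| == 0%N).
      by rewrite {1}card_d.
    rewrite {1}card_d /=.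
    apply: prod_lteif => i /andP[ik il]; rewrite absC_ge0 /=.
    apply: real_embedding_trd_lt4 nx xN1 => [|s' _]; last exact: div_s.
    have [//|e|e] := cplx (s i).
      by case/eqP: ik; apply: inj => y; rewrite e sk.
    by case/eqP: il; apply: inj => y; rewrite e -sl.
  (* The factors at [k] and [l] are conjugate and together give the square. *)
  + move: h; rewrite (bigD1 k) //= (bigD1 l) //= -sk -sl /= absC_conj.
    by rewrite mulrA expr2.
Qed.
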